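(* Let $\mathcal{B}$ be a building set on $[n]$. Then the face poset of the nestomultiplihedron \[ \mathcal{J}\mathcal{B}:=\sum_{B\in\mathcal{B}}\Delta_B+\sum_{B\in\mathcal{B}}\Delta_{B\cup\{n+1\}}\subset\mathbb{R}^{n+1} \] (Minkowski sum) is isomorphic to the opposite of the poset of painted $\mathcal{B}$-forests.
   Context: For $I\subseteq[n+1]$, $\Delta_I=\mathrm{conv}\{e_i: i\in I\}$. A building set on $[n]$ is a collection $\mathcal{B}$ of subsets of $[n]$ such that (B1) if $I,J\in\mathcal{B}$ and $I\cap J\ne\emptyset$ then $I\cup J\in\mathcal{B}$, and (B2) $\{e\}\in\mathcal{B}$ for every $e\in[n]$. A $\mathcal{B}$-forest is a rooted forest whose vertices are labeled by nonempty sets partitioning $[n]$, with roots regarded as the top elements (vertices are ordered by $T\le S$ iff $T$ is a descendant of $S$ or $T=S$), such that, writing $\mathcal{N}_{\le S}$ for the union of the labels of all $T\le S$: (F1) $\mathcal{N}_{\le S}\in\mathcal{B}$ for every vertex $S$; (F2) if $S_1,\dots,S_m$ ($m\ge 2$) are pairwise incomparable vertices then $\bigcup_i\mathcal{N}_{\le S_i}\notin\mathcal{B}$; (F3) the sets $\mathcal{N}_{\le R}$ for the roots $R$ are exactly the inclusion-maximal elements of $\mathcal{B}$. A painted $\mathcal{B}$-forest is a $\mathcal{B}$-forest together with a partition of its vertices into a downset $\mathcal{N}^-$ (white vertices), an antichain $\mathcal{N}^0$ (grey vertices) and an upset $\mathcal{N}^+$ (black vertices) such that $\mathcal{N}^-\cup\mathcal{N}^0$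 is a downset. Contracting an edge between a vertex and its parent removes the edge and merges the two vertices into one vertex labeled by the union of their labels; the merged vertex keeps the common color if both had the same color, and is grey otherwise. For a black vertex $v$, the BG bunch at $v$ is the set of all edges joining $v$ to its grey children; contracting it means contracting all these edges at once (producing a single grey vertex). The partial order on painted $\mathcal{B}$-forests: $\mathcal{N}\ge\mathcal{N}'$ iff $\mathcal{N}'$ is obtained from $\mathcal{N}$ by a finite sequence of the operations: contracting an edge whose endpoints are both black, both white, or grey and white; contracting a BG bunch; converting a black vertex all of whose children are white into a grey vertex; converting a white vertex whose parent is black into a grey vertex.
   Formalization: Members of a building set are required to be nonempty (otherwise the Minkowski sum is empty), and converting a white vertex to grey is also allowed for a white root, which has no parent (needed already for n = 1); the face poset consists of the nonempty faces. *)

(* Defs.v *)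
From Stdlib Require Import Relation_Operators.
From mathcomp Require Import all_boot all_order all_algebra.
From mathcomp Require Import boolp classical_sets functions reals.

Set Implicit Arguments.
Unset Strict Implicit.
Unset Printing Implicit Defensive.

Import GRing.Theory Num.Theory.
Local Open Scope ring_scope.

(* The ground set [n] is 'I_n. *)

(* Members of a building set are nonempty: for the empty set, Delta would be
   empty, and so would every Minkowski sum having it as a summand. *)
Definition building_set (n : nat) (B : {set {set 'I_n}}) : Prop :=
  [/\ finset.set0 \notin B,
      forall I J : {set 'I_n}, I \in B -> J \in B ->
        (I :&: J)%SET != finset.set0 -> (I :|: J)%SET \in B &
      forall e : 'I_n, [set e]%SET \in B].

(* Labels are nonempty and pairwise disjoint, so a vertex is identified with
   its label.  An edge is a pair (child, parent). *)
Record forest (n : nat) := Forest {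
  verts : {set {set 'I_n}};
  edges : {set {set 'I_n} * {set 'I_n}} }.

Section Forests.
Variable n : nat.
Local Notation vertex := {set 'I_n}.
Implicit Types (F : forest n) (B Z : {set vertex}) (S T : vertex).

(* T <= S : T is S or a descendant of S *)
Definition fle F : rel vertex := connect [rel T S | (T, S) \in edges F].

Definition children F S : {set vertex} :=
  [set T in verts F | (T, S) \in edges F]%SET.

Definition roots F : {set vertex} :=
  [set R in verts F | [forall S, (R, S) \notin edges F]]%SET.

Definition rooted_forest F : Prop :=
  [/\ finset.partition (verts F) [set: 'I_n]%SET,
      forall T S, (T, S) \in edges F -> (T \in verts F) && (S \in verts F),
      forall T S S', (T, S) \in edges F -> (T, S') \in edges F -> S = S' &
      forall T S, (T, S) \in edges F -> ~~ fle F S T].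

Definition down_union F S : {set 'I_n} :=
  (\bigcup_(T in verts F | fle F T S) T)%SET.

Definition pairwise_incomparable F Z : Prop :=
  forall S T, S \in Z -> T \in Z -> S != T -> ~~ fle F S T.

Definition downset F Z : Prop :=
  forall S T, S \in Z -> T \in verts F -> fle F T S -> T \in Z.

Definition upset F Z : Prop :=
  forall S T, S \in Z -> T \in verts F -> fle F S T -> T \in Z.

Definition B_forest B F : Prop :=
  [/\ rooted_forest F,
      forall S, S \in verts F -> down_union F S \in B,
      forall Z, Z \subset verts F -> (1 < #|Z|)%N ->
        pairwise_incomparable F Z ->
        (\bigcup_(S in Z) down_union F S)%SET \notin B &
      [set down_union F R | R in roots F]%SET
        = [set I in B | maxset (fun J => J \in B) I]%SET].

End Forests.

Record painted (n : nat) := Painted {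
  pforest :> forest n;
  white : {set {set 'I_n}};
  grey : {set {set 'I_n}};
  black : {set {set 'I_n}} }.

Section PaintedForests.
Variable n : nat.
Local Notation vertex := {set 'I_n}.
Implicit Types (N : painted n) (B C Z : {set vertex}) (S T v : vertex).

Definition painting N : Prop :=
  [/\ (white N :|: grey N :|: black N)%SET = verts N,
      [disjoint white N & grey N],
      [disjoint white N & black N] &
      [disjoint grey N & black N]]
  /\
  [/\ downset N (white N),
      pairwise_incomparable N (grey N),
      upset N (black N) &
      downset N (white N :|: grey N)%SET].

Definition painted_B_forest B N : Prop := B_forest B N /\ painting N.

(* Contraction of all the edges joining v to its children in C.  The merged
   vertex keeps the color of v and C if they all have the same one, and is grey
   otherwise. *)
Definition contract N v C : painted n :=
  let K := (v |: C)%SET in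
  let M := (\bigcup_(X in K) X)%SET in
  let mu X := if X \in K then M else X in
  Painted
    (Forest
      [set mu X | X in verts N]%SET
      [set (mu e.1, mu e.2)
        | e in [set e in edges N | ~~ ((e.1 \in C) && (e.2 == v))]]%SET)
    (if K \subset white N then (M |: (white N :\: K))%SET
     else (white N :\: K)%SET)
    (if (K \subset white N) || (K \subset black N) then (grey N :\: K)%SET
     else (M |: (grey N :\: K))%SET)
    (if K \subset black N then (M |: (black N :\: K))%SET
     else (black N :\: K)%SET).

Definition paint_grey N v : painted n :=
  Painted (pforest N) (white N :\ v)%SET (v |: grey N)%SET (black N :\ v)%SET.

(* In step_white_grey a root has no parent, so the condition on the parent holds
   for a white root. *)
Inductive step N : painted n -> Prop :=
| step_edge T v : (T, v) \in edges N ->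
    [\/ (v \in black N) && (T \in black N),
        (v \in white N) && (T \in white N),
        (v \in grey N) && (T \in white N) |
        (v \in white N) && (T \in grey N)] ->
    step N (contract N v [set T]%SET)
| step_bunch v : v \in black N ->
    (children N v :&: grey N)%SET != finset.set0 ->
    step N (contract N v (children N v :&: grey N)%SET)
| step_black_grey v : v \in black N -> children N v \subset white N ->
    step N (paint_grey N v)
| step_white_grey v : v \in white N ->
    (forall S, (v, S) \in edges N -> S \in black N) ->
    step N (paint_grey N v).

(* The operations act on painted B-forests: contracting the BG bunch at a black
   vertex that also has a black child is excluded, since a grey vertex may not
   have a black child. *)
Definition B_step B N N' : Prop :=
  [/\ painted_B_forest B N, painted_B_forest B N' & step N N'].

Definition painted_ge B : painted n -> painted n -> Prop :=
  clos_refl_trans (painted n) (B_step B).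

End PaintedForests.

Local Open Scope classical_set_scope.

Section Polytopes.
Variables (R : realType) (d : nat).
Local Notation V := 'rV[R]_d.

Definition conv (A : set V) : set V :=
  [set x | exists (k : nat) (p : 'I_k -> V) (c : 'I_k -> R),
    [/\ forall i, A (p i), forall i, 0 <= c i, \sum_i c i = 1 &
        x = \sum_i c i *: p i]].

Definition Delta (I : {set 'I_d}) : set V :=
  conv [set x | exists2 i, i \in I & x = delta_mx 0 i].

Definition mink_add (P Q : set V) : set V :=
  [set x | exists p q, [/\ P p, Q q & x = p + q]].

Definition mink_sum (I : finType) (A : {set I}) (P : I -> set V) : set V :=
  [set x | exists2 p : I -> V,
    forall i, i \in A -> P i (p i) & x = \sum_(i in A) p i].

(* F is a nonempty face of P: the subset of P maximizing some linear functional;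
   the zero functional yields P itself. *)
Definition face (P F : set V) : Prop :=
  F !=set0 /\
  exists y : V, F = [set x | P x /\
    forall z, P z -> \sum_i y 0 i * z 0 i <= \sum_i y 0 i * x 0 i].

End Polytopes.

(* [n] is the set of the first n elements of [n+1] = 'I_n.+1, and n+1 is
   ord_max. *)
Definition incl (n : nat) (I : {set 'I_n}) : {set 'I_n.+1} :=
  [set widen_ord (leqnSn n) i | i in I]%SET.

Definition nestomultiplihedron (R : realType) (n : nat) (B : {set {set 'I_n}}) :
    set 'rV[R]_n.+1 :=
  mink_add (mink_sum B (fun I => Delta (R := R) (incl I)))
           (mink_sum B (fun I => Delta (R := R) (ord_max |: incl I)%SET)).

Arguments nestomultiplihedron R {n} B.

Definition poset_iso (T U : Type) (A : set T) (leA : T -> T -> Prop)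
    (C : set U) (leC : U -> U -> Prop) : Prop :=
  exists f : T -> U, set_bij A C f /\
    forall x y, A x -> A y -> (leA x y <-> leC (f x) (f y)).

Definition opposite (T : Type) (r : T -> T -> Prop) : T -> T -> Prop :=
  fun x y => r y x.

Definition painted_le (n : nat) (B : {set {set 'I_n}}) :
    painted n -> painted n -> Prop :=
  fun N' N => painted_ge B N N'.

(* Main.v *)
From Stdlib Require Import Relation_Operators.
From mathcomp Require Import all_boot all_order all_algebra.
Require Import Defs.

Set Implicit Arguments.
Unset Strict Implicit.
Unset Printing Implicit Defensive.

(** A [B]-forest amounts to the nested set [Q] of its sets [down_union S], and a
    painting to a coloring [c] of [Q].  In terms of [(Q, c)] the generating moves
    remove children of a member of [Q] or turn a color into grey, and the order
    becomes [coarsens]: [Q' \subset Q], and the color of [I] in [Q] is kept or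
    becomes grey in passing to the least member of [Q'] above [I].

    A face of a Minkowski sum of simplices is determined by the sets of maximizers
    of a linear functional [(y, t)] on the summands, and faces are ordered as these
    sets.  The functional yields a colored nested set: [Q] consists of the
    components of the sublevel sets of [y], and the maximum of [y] on [I] in [Q]
    is compared with [t] to color [I].  Inclusion of the sets of maximizers is
    exactly [coarsens], and every colored nested set arises from some [(y, t)]. *)

(** * Nested sets *)

(** Moves are hard to control one by one: their results must be painted [B]-forests again, so from a
    coarsening one has to find a move that is legal and does not overshoot the target. The delicate
    case is a member to be deleted that is not black while its parent is. If it is grey, contracting
    its edge alone would leave any other grey child below a grey vertex; hence all grey children are
    absorbed at once. If it is white, it is turned grey beforehand.

    On the polytope side, a face involves one set of maximizers for every element of [B], while the
    nested set is usually much smaller. The link is that every [J] in [B] is contained in the least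
    member of [Q] around one of its own elements. So [J] has a least member of [Q] above it, and
    when [Q] comes from [y], the maximum of [y] on that member is its maximum on [J]. Data on [Q]
    therefore control all summands. *)

Definition nested (n : nat) (B Q : {set {set 'I_n}}) : Prop :=
  [/\ Q \subset B,
      forall Z : {set {set 'I_n}}, Z \subset Q -> 1 < #|Z| ->
        {in Z &, forall I J : {set 'I_n}, I != J -> ~~ (I \subset J)} ->
        \bigcup_(I in Z) I \notin B &
      forall I : {set 'I_n}, maxset (fun J => J \in B) I -> I \in Q].

(** For laminar [Q] and [I] in [Q] this is [I] minus the members of [Q] strictly inside it: the
    vertex of the forest that corresponds to [I]. *)
Definition label (n : nat) (Q : {set {set 'I_n}}) (I : {set 'I_n}) : {set 'I_n} :=
  [set i in I | [forall J in Q, (i \in J) ==> (I \subset J)]].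

(** For nested [Q] this is a member of [Q], the one whose label contains [i]. *)
Definition hull (n : nat) (Q : {set {set 'I_n}}) (i : 'I_n) : {set 'I_n} :=
  \bigcap_(J in Q | i \in J) J.

Definition parent (n : nat) (Q : {set {set 'I_n}}) (I J : {set 'I_n}) : bool :=
  (I \proper J) && [forall K in Q, (I \proper K) ==> (J \subset K)].

Section Nested.
Variables (n : nat) (B Q : {set {set 'I_n}}).
Hypotheses (hB : building_set B) (hQ : nested B Q).
Implicit Types (i j k : 'I_n) (I J K P : {set 'I_n}).

Lemma labelP I i :
  reflect (i \in I /\ {in Q, forall J, i \in J -> I \subset J}) (i \in label Q I).
Proof.
rewrite inE; apply: (iffP andP) => [[iI /forallP h]|[iI h]]; split=> //.
  by move=> J JQ iJ; move: (h J); rewrite JQ iJ.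
by apply/forallP => J; apply/implyP => JQ; apply/implyP; apply: h.
Qed.

Lemma parentP I J :
  reflect (I \proper J /\ {in Q, forall K, I \proper K -> J \subset K}) (parent Q I J).
Proof.
apply: (iffP andP) => [[IJ /forallP h]|[IJ h]]; split=> //.
  by move=> K KQ IK; move: (h K); rewrite KQ IK.
by apply/forallP => K; apply/implyP => KQ; apply/implyP; apply: h.
Qed.

Lemma label_sub I : label Q I \subset I.
Proof. by apply/subsetP => i /labelP[]. Qed.

Lemma nested_building I : I \in Q -> I \in B.
Proof. by case: hQ => /subsetP h _ _; apply: h. Qed.

Lemma building_neq0 I : I \in B -> I != set0.
Proof. by case: hB => h _ _ IB; apply: contraNneq h => <-. Qed.

Lemma building_setU I J i : I \in B -> J \in B -> i \in I -> i \in J -> I :|: J \in B.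
Proof.
case: hB => _ h _ IB JB iI iJ; apply: h => //.
by apply/set0Pn; exists i; rewrite inE iI.
Qed.

(** Two incomparable members that meet would form an antichain whose union is in [B] by (B1). *)
Lemma nested_laminar I J i :
  I \in Q -> J \in Q -> i \in I -> i \in J -> (I \subset J) || (J \subset I).
Proof.
move=> IQ JQ iI iJ; apply/negP => /negP; rewrite negb_or => /andP[nIJ nJI].
have neIJ : I != J by apply: contraNneq nIJ => ->.
case: hQ => _ h _.
have : \bigcup_(K in [set I; J]) K \notin B.
  apply: h; first by apply/subsetP => K /set2P[]->.
    by rewrite cards2 neIJ.
  by move=> K L /set2P[]-> /set2P[]->; rewrite ?eqxx.
rewrite big_setU1 ?inE // big_set1.
by rewrite (@building_setU I J i) // nested_building.
Qed.

(** A maximal element of [B] above the singleton of [i] belongs to [Q], so some member contains [i];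
    by laminarity one of least cardinality lies inside all the others. *)
Lemma exists_labeled i : exists2 H, H \in Q & i \in label Q H.
Proof.
have [H0 H0Q iH0] : exists2 H, H \in Q & i \in H.
  have : [set i] \in B by case: hB.
  case/(@maxset_exists _ (fun J => J \in B)) => H maxH; rewrite sub1set => iH.
  by exists H => //; case: hQ => _ _; apply.
have := @arg_minnP _ H0 (fun H => (H \in Q) && (i \in H)) (fun H => #|H|).
rewrite H0Q iH0 => /(_ isT); case=> H /andP[HQ iH] minH.
exists H => //; apply/labelP; split=> // J JQ iJ.
have /orP[//|JH] := nested_laminar HQ JQ iH iJ.
have /eqP-> : J == H by rewrite eqEcard JH minH // JQ iJ.
exact: subxx.
Qed.

Lemma label_hull i H : H \in Q -> i \in label Q H -> hull Q i = H.
Proof.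
move=> HQ /labelP[iH h]; apply/eqP; rewrite eqEsubset; apply/andP; split.
  by apply: bigcap_inf; rewrite HQ.
by apply/bigcapsP => J /andP[JQ]; apply: h.
Qed.

Lemma hull_in i : hull Q i \in Q.
Proof. by have [H HQ /(label_hull HQ)->] := exists_labeled i. Qed.

Lemma hull_label i : i \in label Q (hull Q i).
Proof. by have [H HQ iH] := exists_labeled i; rewrite (label_hull HQ iH). Qed.

Lemma mem_hull i : i \in hull Q i.
Proof. exact: subsetP (label_sub _) _ (hull_label i). Qed.

Lemma hull_min i J : J \in Q -> i \in J -> hull Q i \subset J.
Proof. by move=> JQ iJ; apply: bigcap_inf; rewrite JQ. Qed.

(* The union of the hulls of the elements of [J] is in [B]; hence only one of
   them is maximal. *)
Lemma building_sub_hull J : J \in B -> exists2 k, k \in J & J \subset hull Q k.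
Proof.
move=> JB; set HJ := [set hull Q j | j in J].
have UB : \bigcup_(j in J) hull Q j \in B.
  (* Starting from [J], the hulls are added one at a time: the hull of [j] meets the set built so
     far in [j], so (B1) applies. *)
  have : J :|: \bigcup_(j in J) hull Q j \in B.
    elim/big_rec: _ => [|j X jJ JX]; first by rewrite setU0.
    rewrite setUCA; apply: (@building_setU _ _ j) => //.
    - exact: nested_building (hull_in j).
    - exact: mem_hull.
    - by rewrite inE jJ.
  suff /setUidPr-> : J \subset \bigcup_(j in J) hull Q j by [].
  by apply/subsetP => j jJ; apply/bigcupP; exists j => //; apply: mem_hull.
pose Z := [set H | maxset (fun H => H \in HJ) H].
have ZHJ H : H \in Z -> H \in HJ by rewrite inE => /maxsetp.
have coverZ j : j \in J -> exists2 H, H \in Z & hull Q j \subset H.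
  move=> jJ; have : hull Q j \in HJ by apply: imset_f.
  case/(@maxset_exists _ (fun H => H \in HJ)) => H mH sH.
  by exists H => //; rewrite inE.
have UZ : \bigcup_(I in Z) I = \bigcup_(j in J) hull Q j.
  apply/eqP; rewrite eqEsubset; apply/andP; split; apply/bigcupsP.
    by move=> H /ZHJ/imsetP[j jJ ->]; apply: bigcup_sup.
  by move=> j /coverZ[H HZ sH]; apply: subset_trans sH _; apply: bigcup_sup.
case: (leqP #|Z| 1) => [Z1|Z2]; last first.
  case: hQ => _ /(_ Z) h _; suff : \bigcup_(I in Z) I \notin B by rewrite UZ UB.
  apply: h => //.
    by apply/subsetP => H /ZHJ /imsetP[j _ ->]; apply: hull_in.
  move=> I K; rewrite !inE => mI mK; apply: contraNN => IK.
  by apply/eqP; apply/esym; apply: (maxsetsup mI) => //; apply: maxsetp mK.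
have /set0Pn[j0 j0J] := building_neq0 JB.
have [H HZ _] := coverZ j0 j0J.
have /imsetP[k kJ Hk] := ZHJ _ HZ.
exists k => //; rewrite -Hk; apply/subsetP => j jJ.
have [H' H'Z /subsetP/(_ _ (mem_hull j))] := coverZ j jJ.
by rewrite (card_le1P Z1 H HZ) in H'Z; move: H'Z => /eqP->.
Qed.

(** [I] is contained in, hence equal to, the hull of one of its own elements, and that element is in
    the label. *)
Lemma label_neq0 I : I \in Q -> label Q I != set0.
Proof.
move=> IQ; have [k kI sI] := building_sub_hull (nested_building IQ).
apply/set0Pn; exists k; have -> // : I = hull Q k.
  by apply/eqP; rewrite eqEsubset sI hull_min.
exact: hull_label.
Qed.

Lemma label_inj : {in Q &, injective (label Q)}.
Proof.
move=> I J IQ JQ eqIJ; have /set0Pn[i iI] := label_neq0 IQ.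
by rewrite -(label_hull IQ iI) (label_hull JQ) -?eqIJ.
Qed.

Lemma parent_exists I J : I \in Q -> J \in Q -> I \proper J ->
  exists2 K, K \in Q & parent Q I K.
Proof.
move=> IQ JQ IJ.
have /set0Pn[i iI] := building_neq0 (nested_building IQ).
have := @arg_minnP _ J (fun H => (H \in Q) && (I \proper H)) (fun H => #|H|).
rewrite JQ IJ => /(_ isT); case=> H /andP[HQ iH] minH.
exists H => //; apply/parentP; split=> // K KQ IK.
have iHH := subsetP (proper_sub iH) i iI; have iK := subsetP (proper_sub IK) i iI.
have /orP[//|KH] := nested_laminar HQ KQ iHH iK.
have /eqP-> : K == H by rewrite eqEcard KH minH // KQ IK.
exact: subxx.
Qed.

Lemma parent_unique I J K : J \in Q -> K \in Q ->
  parent Q I J -> parent Q I K -> J = K.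
Proof.
move=> JQ KQ /parentP[IJ hJ] /parentP[IK hK].
by apply/eqP; rewrite eqEsubset hJ // hK.
Qed.

End Nested.

(** * The painted forest of a colored nested set *)

Notation white_color := (Some false).
Notation grey_color := (@None bool).
Notation black_color := (Some true).

Definition color_class (n : nat) (Q : {set {set 'I_n}})
    (c : {set 'I_n} -> option bool) (x : option bool) : {set {set 'I_n}} :=
  [set label Q I | I in [set I in Q | c I == x]].

Definition painted_of_nested (n : nat) (Q : {set {set 'I_n}})
    (c : {set 'I_n} -> option bool) : painted n :=
  Painted
    (Forest (label Q @: Q)
       [set e | [exists I in Q, exists J in Q,
          parent Q I J && (e == (label Q I, label Q J))]])
    (color_class Q c white_color) (color_class Q c grey_color)
    (color_class Q c black_color).

(* Equivalent to the four order conditions of [painting] together. *)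
Definition monotone_coloring (n : nat) (Q : {set {set 'I_n}})
    (c : {set 'I_n} -> option bool) : Prop :=
  {in Q &, forall I J : {set 'I_n}, I \proper J ->
     (c I == white_color) || (c J == black_color)}.

Section PaintedOfNested.
Variables (n : nat) (B Q : {set {set 'I_n}}) (c : {set 'I_n} -> option bool).
Hypotheses (hB : building_set B) (hQ : nested B Q).
Implicit Types (i j k : 'I_n) (I J K P : {set 'I_n}).
Local Notation N := (painted_of_nested Q c).

Lemma edge_of_nestedP e :
  reflect (exists I J, [/\ I \in Q, J \in Q, parent Q I J & e = (label Q I, label Q J)])
    (e \in edges N).
Proof.
rewrite inE; apply: (iffP existsP) => [[I /andP[IQ /existsP[J /and3P[JQ p /eqP->]]]]|].
  by exists I, J.
case=> I [J [IQ JQ p ->]]; exists I; rewrite IQ /=.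
by apply/existsP; exists J; rewrite JQ p /=.
Qed.

Lemma edge_of_nested I J : I \in Q -> J \in Q ->
  ((label Q I, label Q J) \in edges N) = parent Q I J.
Proof.
move=> IQ JQ; apply/edge_of_nestedP/idP => [[I' [J' [I'Q J'Q p [eI eJ]]]]|p].
  by rewrite (label_inj hB hQ IQ I'Q eI) (label_inj hB hQ JQ J'Q eJ).
by exists I, J.
Qed.

(** For the path from [I] up to [J]: the parent of [I] is still inside [J], and the difference of
    the cardinalities drops. *)
Lemma fle_of_nested I J : I \in Q -> J \in Q ->
  fle N (label Q I) (label Q J) = (I \subset J).
Proof.
move=> IQ JQ; apply/idP/idP => [/connectP[p]|].
  elim: p I IQ => [|X p IH] I IQ /= => [_ eIJ|/andP[eX pX] lX].
    by rewrite (label_inj hB hQ JQ IQ eIJ).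
  have /edge_of_nestedP[I' [K [I'Q KQ pK [eI eK]]]] := eX.
  rewrite -(label_inj hB hQ IQ I'Q eI) in pK.
  case/parentP: pK => /proper_sub IK _; apply: subset_trans IK _.
  by apply: IH => //; rewrite -eK.
have [m] := ubnP (#|J| - #|I|); elim: m I IQ => // m IH I IQ lem IJ.
have [->|neIJ] := eqVneq I J; first exact: connect0.
have pIJ : I \proper J by rewrite properEneq neIJ.
have [K KQ pK] := parent_exists hB hQ IQ JQ pIJ.
have /parentP[IK KJ] := pK.
apply: (@connect_trans _ _ (label Q K)); first by rewrite connect1 //= edge_of_nested.
apply: IH => //; last exact: KJ.
have := proper_card IK; have := subset_leq_card (KJ J JQ pIJ) => le1 lt2.
rewrite ltnS in lem; apply: leq_trans lem.
by apply: ltn_sub2l => //; apply: leq_trans lt2 _.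
Qed.

Lemma down_union_of_nested I : I \in Q -> down_union N (label Q I) = I.
Proof.
move=> IQ; apply/eqP; rewrite eqEsubset; apply/andP; split.
  apply/bigcupsP => T /andP[/imsetP[J JQ ->]]; rewrite fle_of_nested // => JI.
  exact: subset_trans (label_sub _ _) JI.
apply/subsetP => i iI; apply/bigcupP; exists (label Q (hull Q i)).
  have hQi := hull_in hB hQ i.
  by rewrite imset_f // fle_of_nested // hull_min.
exact: (hull_label hB hQ).
Qed.

Lemma rooted_forest_of_nested : rooted_forest N.
Proof.
split.
- apply/and3P; split.
  + apply/eqP/setP => i; rewrite inE; apply/bigcupP; exists (label Q (hull Q i)).
      by rewrite imset_f // (hull_in hB hQ).
    exact: (hull_label hB hQ).
  + apply/trivIsetP => S T /imsetP[I IQ ->] /imsetP[J JQ ->].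
    apply: contraR => /pred0Pn[i /andP[/= iI iJ]].
    by rewrite -(label_hull IQ iI) -(label_hull JQ iJ).
  + apply/imsetP => -[I IQ /esym/eqP].
    by apply/negP; apply: (label_neq0 hB hQ).
- by move=> T S /edge_of_nestedP[I [J [IQ JQ _ [-> ->]]]]; rewrite !imset_f.
- move=> T S S' /edge_of_nestedP[I [J [IQ JQ p [-> ->]]]].
  case/edge_of_nestedP => I' [J' [I'Q J'Q p' [eI ->]]].
  rewrite -(label_inj hB hQ IQ I'Q eI) in p'.
  by rewrite (parent_unique JQ J'Q p p').
- move=> T S /edge_of_nestedP[I [J [IQ JQ /parentP[+ _] [-> ->]]]].
  by rewrite fle_of_nested // properE => /andP[].
Qed.

Lemma roots_of_nested :
  Defs.roots N = label Q @: [set I in B | maxset (fun J => J \in B) I].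
Proof.
have [_ _ hmax] := hQ.
apply/setP => S; apply/idP/imsetP => [|[I]].
  rewrite inE => /andP[/imsetP[I IQ ->] /forallP hI].
  exists I => //; rewrite inE (nested_building hQ) //=.
  have [M maxM IM] := @maxset_exists _ (fun J => J \in B) I (nested_building hQ IQ).
  have [->//|neIM] := eqVneq I M.
  have pIM : I \proper M by rewrite properEneq neIM.
  have [K KQ pK] := parent_exists hB hQ IQ (hmax _ maxM) pIM.
  by have := hI (label Q K); rewrite edge_of_nested ?pK.
rewrite inE => /andP[IB mI] ->; have IQ := hmax I mI.
rewrite inE imset_f //=; apply/forallP => S'; apply/edge_of_nestedP.
case=> I' [J [I'Q JQ /parentP[IJ _] [/(label_inj hB hQ IQ I'Q) eI _]]].
rewrite -eI in IJ; have := maxsetsup mI (nested_building hQ JQ) (proper_sub IJ).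
by move=> eJ; rewrite eJ properxx in IJ.
Qed.

(** Incomparable vertices are labels of incomparable sets, so (F2) becomes the antichain condition
    on [Q]. *)
Lemma B_forest_of_nested : B_forest B N.
Proof.
have [_ hanti hmax] := hQ.
split; first exact: rooted_forest_of_nested.
- by move=> S /imsetP[I IQ ->]; rewrite down_union_of_nested // (nested_building hQ).
- move=> Z ZQ Z1 hZ; pose Z' := [set I in Q | label Q I \in Z].
  have eZ : Z = label Q @: Z'.
    apply/setP => S; apply/idP/imsetP => [SZ|[I + ->]]; last by rewrite inE => /andP[].
    have /imsetP[I IQ eS] := subsetP ZQ S SZ.
    by exists I => //; rewrite inE IQ -eS.
  have Z'Q I : I \in Z' -> I \in Q by rewrite inE => /andP[].
  have -> : \bigcup_(S in Z) down_union N S = \bigcup_(I in Z') I.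
    rewrite eZ big_imset /=; last by move=> I J /Z'Q IQ /Z'Q JQ; apply: (label_inj hB hQ).
    by apply: eq_bigr => I /Z'Q; apply: down_union_of_nested.
  apply: hanti; first by apply/subsetP.
    apply: leq_trans Z1 _; rewrite eZ; exact: leq_imset_card.
  move=> I J; rewrite !inE => /andP[IQ IZ] /andP[JQ JZ] neIJ.
  rewrite -fle_of_nested //; apply: hZ => //.
  by apply: contraNneq neIJ => /(label_inj hB hQ IQ JQ) ->.
- rewrite roots_of_nested -imset_comp -[RHS]imset_id.
  by apply: eq_in_imset => I; rewrite inE => /andP[_ /hmax] /down_union_of_nested.
Qed.

Lemma mem_color_class I x : I \in Q -> (label Q I \in color_class Q c x) = (c I == x).
Proof.
move=> IQ; apply/imsetP/idP => [[J]|cI].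
  by rewrite inE => /andP[JQ cJ] /(label_inj hB hQ IQ JQ)->.
by exists I => //; rewrite inE IQ.
Qed.

Lemma color_classP S x :
  reflect (exists I, [/\ I \in Q, c I = x & S = label Q I]) (S \in color_class Q c x).
Proof.
apply: (iffP imsetP) => [[I]|[I [IQ cI ->]]].
  by rewrite inE => /andP[IQ /eqP cI] ->; exists I.
by exists I => //; rewrite inE IQ cI /=.
Qed.

Lemma disjoint_color_class x y : x != y -> [disjoint color_class Q c x & color_class Q c y].
Proof.
move=> nexy; apply/pred0P => S; apply/negP => /andP[/= /color_classP[I [IQ cI ->]]].
by rewrite mem_color_class // cI (negPf nexy).
Qed.

Lemma painting_of_nestedP : painting N <-> monotone_coloring Q c.
Proof.
split=> [[_ [wd gi bu wgd]] I J IQ JQ IJ|mc].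
  have flIJ : fle N (label Q I) (label Q J) by rewrite fle_of_nested // proper_sub.
  have neIJ : label Q I != label Q J.
    by apply/eqP => /(label_inj hB hQ IQ JQ) eIJ; rewrite eIJ properxx in IJ.
  have IV : label Q I \in verts N by rewrite imset_f.
  have JV : label Q J \in verts N by rewrite imset_f.
  case cI : (c I) => [[]|] //=; last first.
    case cJ : (c J) => [[]|] //=.
      have := wd (label Q J) (label Q I); rewrite /= !mem_color_class // cI cJ.
      by move=> /(_ isT IV flIJ).
    have := gi (label Q I) (label Q J); rewrite /= !mem_color_class // cI cJ.
    by move=> /(_ isT isT neIJ); rewrite flIJ.
  have := bu (label Q I) (label Q J); rewrite /= !mem_color_class // cI.
  by move=> /(_ isT JV flIJ).
split; split.
- apply/setP => S; apply/idP/imsetP => [|[I IQ ->]].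
    by rewrite !inE => /orP[/orP[]|] /color_classP[I [IQ cI ->]]; exists I.
  by rewrite !inE !mem_color_class //; case: (c I) => [[]|].
- exact: disjoint_color_class.
- exact: disjoint_color_class.
- exact: disjoint_color_class.
- move=> S T /color_classP[J [JQ cJ ->]] /imsetP[I IQ ->]; rewrite fle_of_nested // => IJ.
  rewrite mem_color_class //; have [->|neIJ] := eqVneq I J; first by rewrite cJ.
  by have := mc I J IQ JQ; rewrite properEneq neIJ IJ cJ orbF => /(_ isT).
- move=> S T /color_classP[I [IQ cI ->]] /color_classP[J [JQ cJ ->]] neIJ.
  rewrite fle_of_nested //; apply/negP => IJ.
  have := mc I J IQ JQ; rewrite properEneq IJ cI cJ andbT orbF.
  suff -> : I != J by move=> /(_ isT).
  by apply: contraNneq neIJ => ->.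
- move=> S T /color_classP[I [IQ cI ->]] /imsetP[J JQ ->]; rewrite fle_of_nested // => IJ.
  rewrite mem_color_class //; have [<-|neIJ] := eqVneq I J; first by rewrite cI.
  by have := mc I J IQ JQ; rewrite properEneq neIJ IJ cI => /(_ isT).
- move=> S T SWG /imsetP[I IQ ->].
  have [J [JQ cJ ->]] : exists J, [/\ J \in Q, c J != black_color & S = label Q J].
    by move: SWG; rewrite inE => /orP[] /color_classP[J [JQ cJ eS]]; exists J; rewrite cJ.
  rewrite fle_of_nested // => IJ; rewrite inE !mem_color_class //.
  suff : c I != black_color by case: (c I) => [[]|].
  have [->//|neIJ] := eqVneq I J.
  have := mc I J IQ JQ; rewrite properEneq neIJ IJ (negPf cJ) orbF => /(_ isT).
  by move=> /eqP->.
Qed.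

Lemma painted_B_forest_of_nested :
  painted_B_forest B N <-> monotone_coloring Q c.
Proof.
split=> [[_ /painting_of_nestedP]//|mc].
by split; [apply: B_forest_of_nested|apply/painting_of_nestedP].
Qed.

End PaintedOfNested.

(** * The colored nested set of a painted forest *)

Section RootedForest.
Variables (n : nat) (F : forest n).
Hypothesis hF : rooted_forest F.
Implicit Types (S T U : {set 'I_n}).

Lemma fle_first_edge S T : fle F S T -> S != T ->
  exists2 S', (S, S') \in edges F & fle F S' T.
Proof.
case/connectP => [[|S' p] /=]; first by move=> _ ->; rewrite eqxx.
by move=> /andP[eS pS] -> _; exists S' => //; apply/connectP; exists p.
Qed.

Lemma fle_antisym S T : fle F S T -> fle F T S -> S = T.
Proof.
move=> ST TS; apply/eqP; apply/negPn/negP => neST.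
have [S' eS S'T] := fle_first_edge ST neST.
have [_ _ _ /(_ _ _ eS)/negP] := hF; apply.
exact: connect_trans S'T TS.
Qed.

Lemma verts_disjoint S T (i : 'I_n) :
  S \in verts F -> T \in verts F -> i \in S -> i \in T -> S = T.
Proof.
have [/and3P[_ /trivIsetP h _] _ _ _] := hF => SV TV iS iT.
apply/eqP; apply/negPn/negP => /(h S T SV TV)/pred0P/(_ i).
by rewrite /= iS iT.
Qed.

Lemma sub_down_union S : S \in verts F -> S \subset down_union F S.
Proof. by move=> SV; apply: bigcup_sup; rewrite SV; apply: connect0. Qed.

Lemma mem_down_union S T i : S \in verts F -> i \in S ->
  (i \in down_union F T) = fle F S T.
Proof.
move=> SV iS; apply/bigcupP/idP => [[U /andP[UV UT] iU]|ST].
  by rewrite (verts_disjoint SV UV iS iU).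
by exists S => //; rewrite SV.
Qed.

(** One element of the nonempty label [S] decides: since labels are disjoint, it lies in the union
    below [T] only if [S] itself is below [T]. *)
Lemma down_union_subset S T : S \in verts F ->
  (down_union F S \subset down_union F T) = fle F S T.
Proof.
move=> SV; apply/idP/idP => [sST|ST].
  have [/and3P[_ _ n0] _ _ _] := hF.
  have /set0Pn[i iS] : S != set0 by apply: contraNneq n0 => <-.
  rewrite -(mem_down_union T SV iS); apply: (subsetP sST).
  exact: subsetP (sub_down_union SV) _ iS.
apply/bigcupsP => U /andP[UV US]; apply: bigcup_sup.
by rewrite UV; apply: connect_trans US ST.
Qed.

Lemma down_union_inj : {in verts F &, injective (down_union F)}.
Proof.
by move=> S T SV TV eST; apply: fle_antisym; rewrite -down_union_subset // eST.
Qed.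

Lemma label_down_union S : S \in verts F ->
  label (down_union F @: verts F) (down_union F S) = S.
Proof.
move=> SV; apply/setP => i; apply/labelP/idP => [[/bigcupP[T /andP[TV TS] iT] h]|iS].
  suff -> : S = T by [].
  apply: fle_antisym => //; rewrite -down_union_subset //.
  by apply: h; [apply: imset_f|apply: subsetP (sub_down_union TV) _ iT].
split; first exact: subsetP (sub_down_union SV) _ iS.
move=> _ /imsetP[U UV ->]; rewrite (mem_down_union _ SV iS).
by rewrite down_union_subset.
Qed.

(** The first edge on the path from [S] to [T] ends at some [S'] below [T], and minimality of [T]
    forces [T = S']. Conversely, every path leaving [S] starts with its only edge. *)
Lemma parent_down_union S T : S \in verts F -> T \in verts F ->
  parent (down_union F @: verts F) (down_union F S) (down_union F T)
  = ((S, T) \in edges F).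
Proof.
have [_ eV euniq eacyc] := hF => SV TV.
have properE S1 T1 : S1 \in verts F -> T1 \in verts F ->
    (down_union F S1 \proper down_union F T1) = (S1 != T1) && fle F S1 T1.
  move=> S1V T1V; rewrite properEneq down_union_subset //; congr (~~ _ && _).
  by apply/eqP/eqP => [/(down_union_inj S1V T1V)|->].
have edgeE S1 T1 : (S1, T1) \in edges F -> (S1 != T1) && fle F S1 T1.
  move=> e; rewrite [fle _ _ _]connect1 // andbT; apply: contraTneq (eacyc _ _ e) => ->.
  by rewrite negbK; apply: connect0.
apply/parentP/idP => [[+ h]|eST].
  rewrite properE // => /andP[neST ST].
  have [S' eS S'T] := fle_first_edge ST neST.
  have /andP[_ S'V] := eV _ _ eS.
  suff -> : T = S' by [].
  apply: fle_antisym => //; rewrite -down_union_subset //; apply: h.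
    exact: imset_f.
  by rewrite properE // edgeE.
split; first by rewrite properE // edgeE.
move=> _ /imsetP[U UV ->]; rewrite properE // => /andP[neSU SU].
have [S' eS S'U] := fle_first_edge SU neSU.
by rewrite down_union_subset // (euniq _ _ _ eST eS).
Qed.

End RootedForest.

Definition nested_of_forest (n : nat) (F : forest n) : {set {set 'I_n}} :=
  down_union F @: verts F.

Definition coloring_of_painted (n : nat) (N : painted n) (I : {set 'I_n}) :
    option bool :=
  if I \in down_union N @: white N then white_color
  else if I \in down_union N @: black N then black_color else grey_color.

Lemma nested_of_B_forest (n : nat) (B : {set {set 'I_n}}) (F : forest n) :
  B_forest B F -> nested B (nested_of_forest F).
Proof.
move=> [hF f1 f2 f3]; split.
- by apply/subsetP => _ /imsetP[S SV ->]; apply: f1.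
- move=> Z ZV Z1 hZ; pose Z' := [set S in verts F | down_union F S \in Z].
  have eZ : Z = down_union F @: Z'.
    apply/setP => I; apply/idP/imsetP => [IZ|[S + ->]]; last by rewrite inE => /andP[].
    have /imsetP[S SV eI] := subsetP ZV I IZ.
    by exists S => //; rewrite inE SV -eI.
  have Z'V S : S \in Z' -> S \in verts F by rewrite inE => /andP[].
  have -> : \bigcup_(I in Z) I = \bigcup_(S in Z') down_union F S.
    by rewrite eZ big_imset //= => S T /Z'V SV /Z'V TV; apply: (down_union_inj hF).
  apply: f2; first by apply/subsetP.
    apply: leq_trans Z1 _; rewrite eZ; exact: leq_imset_card.
  move=> S T; rewrite !inE => /andP[SV SZ] /andP[TV TZ] neST.
  rewrite -(down_union_subset hF) //; apply: hZ => //.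
  by apply: contraNneq neST => /(down_union_inj hF SV TV) ->.
- move=> I mI.
  have : I \in [set I in B | maxset (fun J => J \in B) I].
    by rewrite inE mI (maxsetp mI).
  rewrite -f3 => /imsetP[S]; rewrite inE => /andP[SV _] ->.
  exact: imset_f.
Qed.

(** Equality of records: vertices, edges and the three color classes are all recovered exactly, so
    faces will correspond to painted forests themselves and not to classes of them. *)
Lemma nested_of_paintedK (n : nat) (B : {set {set 'I_n}}) (N : painted n) :
  painted_B_forest B N ->
  painted_of_nested (nested_of_forest N) (coloring_of_painted N) = N.
Proof.
case=> -[hF _ _ _] [[eV dwg dwb dgb] _].
have [_ eedge _ _] := hF.
have dinj := down_union_inj hF.
have wV S : S \in white N -> S \in verts N by rewrite -eV !inE => ->.
have gV S : S \in grey N -> S \in verts N by rewrite -eV !inE => ->; rewrite orbT.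
have bV S : S \in black N -> S \in verts N by rewrite -eV !inE => ->; rewrite orbT.
have memd (A : {set {set 'I_n}}) S : {subset A <= verts N} -> S \in verts N ->
    (down_union N S \in down_union N @: A) = (S \in A).
  move=> AV SV; apply/imsetP/idP => [[T TA /dinj->//]|SA]; last by exists S.
  exact: AV.
have ccE x S : S \in color_class (nested_of_forest N) (coloring_of_painted N) x
    = (S \in verts N) && (coloring_of_painted N (down_union N S) == x).
  apply/imsetP/andP => [[I]|[SV cS]].
    rewrite inE => /andP[/imsetP[T TV ->] cT] ->.
    by rewrite label_down_union.
  exists (down_union N S); last by rewrite label_down_union.
  by rewrite inE cS andbT imset_f.
have colE S : S \in verts N -> coloring_of_painted N (down_union N S) =
   if S \in white N then white_color else
   if S \in black N then black_color else grey_color.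
  by move=> SV; rewrite /coloring_of_painted !memd.
have classE x (A : {set {set 'I_n}}) : {subset A <= verts N} ->
    (forall S, S \in verts N -> (S \in A) = ((if S \in white N then white_color else
      if S \in black N then black_color else grey_color) == x)) ->
    color_class (nested_of_forest N) (coloring_of_painted N) x = A.
  move=> AV hA; apply/setP => S; rewrite ccE.
  have [SV|SV] := boolP (S \in verts N); first by rewrite colE // hA.
  by apply/esym/negP => /AV; apply/negP.
have -> : N = Painted (Forest (verts N) (edges N)) (white N) (grey N) (black N).
  by case: (N) => [[]].
rewrite /painted_of_nested; congr Painted; last first.
- apply: classE => // S SV; have := pred0P dwb S => /=.
  by case: (S \in white N); case: (S \in black N).
- apply: classE => // S SV; have := pred0P dwg S; have := pred0P dgb S => /=.
  move: SV; rewrite -eV !inE.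
  by case: (S \in white N); case: (S \in grey N); case: (S \in black N).
- by apply: classE => // S SV; case: ifP => //; case: ifP.
congr Forest.
  rewrite /nested_of_forest -imset_comp -[RHS]imset_id.
  by apply: eq_in_imset => S SV; rewrite /= label_down_union.
apply/setP => -[S T].
apply/(@edge_of_nestedP _ _ (coloring_of_painted N))/idP.
  case=> _ [_ [/imsetP[S' SV ->] /imsetP[T' TV ->]]].
  by rewrite !label_down_union // parent_down_union // => eST [-> ->].
move=> eST; have /andP[SV TV] := eedge _ _ eST.
exists (down_union N S), (down_union N T).
rewrite !label_down_union // parent_down_union //.
by split=> //; apply: imset_f.
Qed.

(** * Contractions *)

Definition recolor (n : nat) (c : {set 'I_n} -> option bool) (P : {set 'I_n})
    (x : option bool) : {set 'I_n} -> option bool :=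
  fun I => if I == P then x else c I.

(** The color rule of [contract], read on members of the nested set. [A] will always contain the
    parent, so the two tests exclude each other. *)
Definition merged_color (n : nat) (c : {set 'I_n} -> option bool)
    (A : {set {set 'I_n}}) : option bool :=
  if [forall I in A, c I == white_color] then white_color
  else if [forall I in A, c I == black_color] then black_color
  else grey_color.

Section Contraction.
Variables (n : nat) (B Q : {set {set 'I_n}}) (c : {set 'I_n} -> option bool).
Hypotheses (hB : building_set B) (hQ : nested B Q).
Implicit Types (i j k : 'I_n) (I J K P : {set 'I_n}).
Local Notation N := (painted_of_nested Q c).

Variables (P : {set 'I_n}) (C : {set {set 'I_n}}).
Hypotheses (PQ : P \in Q) (CQ : C \subset Q)
  (CP : {in C, forall I : {set 'I_n}, parent Q I P}).
Local Notation Q2 := (Q :\: C).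
Local Notation c2 := (recolor c P (merged_color c (P |: C))).

Let CinQ I : I \in C -> I \in Q. Proof. exact: subsetP CQ I. Qed.

Let PnC : P \notin C.
Proof. by apply/negP => /CP/parentP[]; rewrite properxx. Qed.

Let PQ2 : P \in Q2. Proof. by rewrite inE PnC. Qed.

Let Q2Q I : I \in Q2 -> I \in Q. Proof. by rewrite inE => /andP[]. Qed.

(** Only the maximal elements of [B] are forced into a nested set, and a member of [C] lies strictly
    inside [P]. *)
Lemma nested_contract : nested B Q2.
Proof.
have [QB Qanti Qmax] := hQ; split.
- by apply: subset_trans QB; apply: subsetDl.
- by move=> Z ZQ; apply: Qanti; apply: subset_trans ZQ (subsetDl _ _).
- move=> I mI; rewrite inE Qmax // andbT; apply/negP => /CP/parentP[IP _].
  have := maxsetsup mI (nested_building hQ PQ) (proper_sub IP).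
  by move=> eP; rewrite eP properxx in IP.
Qed.

(** A label can only grow by an element [i] of a removed [J] strictly inside [I]. The parent [P] of
    [J] is then inside [I], and as [P] survives and contains [i], it also contains [I]; so
    [I = P]. *)
Lemma label_contract I : I \in Q2 -> I != P -> label Q2 I = label Q I.
Proof.
move=> IQ2 neIP; have IQ := Q2Q IQ2.
apply/setP => i; apply/labelP/labelP => -[iI h]; split=> // J JQ iJ; last first.
  by apply: h iJ; apply: Q2Q.
have [JC|JnC] := boolP (J \in C); last by apply: h iJ; rewrite inE JnC.
have /orP[//|JI] := nested_laminar hB hQ IQ JQ iI iJ.
have [->|neJI] := eqVneq I J; first exact: subxx.
have /parentP[JP /(_ I IQ)] := CP JC.
rewrite properEneq eq_sym neJI JI => /(_ isT) PI.
have IP : I \subset P by apply: h => //; apply: subsetP (proper_sub JP) _ iJ.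
by case/negP: neIP; rewrite eqEsubset IP.
Qed.

(** The hull in [Q] of an element of the new label is either removed, or survives and contains [P],
    hence equals [P]. *)
Lemma label_contract_merged : label Q2 P = \bigcup_(X in label Q @: (P |: C)) X.
Proof.
apply/setP => i; apply/labelP/bigcupP => [[iP h]|].
  exists (label Q (hull Q i)); last exact: (hull_label hB hQ).
  apply: imset_f; rewrite !inE; have [HC|HnC] := boolP (hull Q i \in C); first by rewrite ?HC orbT.
  by rewrite ?(negPf HnC) orbF eqEsubset hull_min //= h ?(mem_hull hB hQ) // inE HnC (hull_in hB hQ).
case=> _ /imsetP[I /setU1P[->|IC] ->] /labelP[iI h].
  by split=> // J /Q2Q; apply: h.
have /parentP[IP hI] := CP IC; split; first exact: subsetP (proper_sub IP) _ iI.
move=> J JQ2 iJ; apply: hI; first exact: Q2Q.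
rewrite properEneq h ?Q2Q // andbT; apply: contraTneq IC => ->.
by move: JQ2; rewrite inE => /andP[].
Qed.

(** If [J] is removed, a surviving set around [I] contains [J] without being [J], hence contains its
    parent [P]. *)
Lemma parent_contract I J : I \in Q2 -> J \in Q -> parent Q I J ->
  parent Q2 I (if J \in C then P else J).
Proof.
move=> IQ2 JQ /parentP[IJ hJ]; apply/parentP; case: ifP => JC; last first.
  by split=> // K /Q2Q; apply: hJ.
have /parentP[JP hP] := CP JC; split; first exact: proper_trans IJ JP.
move=> K KQ2 IK; apply: hP; first exact: Q2Q.
rewrite properEneq hJ ?Q2Q // andbT; apply: contraTneq JC => ->.
by move: KQ2; rewrite inE => /andP[/negPf->].
Qed.

Lemma contract_of_nested :
  contract N (label Q P) (label Q @: C) = painted_of_nested Q2 c2.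
Proof.
have linj := label_inj hB hQ.
have KQ I : I \in P |: C -> I \in Q by move=> /setU1P[->//|/CinQ].
have memK I : I \in Q -> (label Q I \in label Q @: (P |: C)) = (I \in P |: C).
  move=> IQ; apply/imsetP/idP => [[J JK /linj->//]|IK]; last by exists I.
  exact: KQ.
have memC I : I \in Q -> (label Q I \in label Q @: C) = (I \in C).
  move=> IQ; apply/imsetP/idP => [[J JK /linj->//]|IK]; last by exists I.
  exact: CinQ.
rewrite /contract -imsetU1 -label_contract_merged.
(* [r] is the merging map on sets: the relabeling of vertices done by [contract] sends the label of
   [I] in [Q] to the label of [r I] in the smaller family. *)
pose r I := if I \in C then P else I.
have muE I : I \in Q ->
    (if label Q I \in label Q @: (P |: C) then label Q2 P else label Q I) = label Q2 (r I).
  move=> IQ; rewrite memK // /r !inE.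
  have [IC|InC] := boolP (I \in C); first by rewrite orbT.
  by rewrite orbF; have [->//|neIP] := eqVneq I P; rewrite label_contract // inE InC.
have rQ2 I : I \in Q -> r I \in Q2.
  by rewrite /r => IQ; case: ifP => // InC; rewrite inE InC.
have rid I : I \in Q2 -> r I = I by rewrite /r inE => /andP[/negPf->].
have classD x : color_class Q c x :\: label Q @: (P |: C)
    = label Q2 @: [set I in Q2 | (I != P) && (c I == x)].
  apply/setP => S; rewrite inE; apply/andP/imsetP.
    case=> + /color_classP[I [IQ cI eS]]; rewrite eS memK // !inE negb_or.
    case/andP=> neIP InC; exists I; first by rewrite !inE InC IQ neIP cI /=.
    by rewrite label_contract // inE InC.
  case=> I; rewrite inE => /and3P[IQ2 neIP cI] ->.
  have IQ := Q2Q IQ2; rewrite label_contract // memK // !inE (negPf neIP) /=.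
  move: (IQ2); rewrite inE => /andP[-> _]; split=> //.
  by rewrite (mem_color_class _ hB hQ).
have imE (A A' : {set {set 'I_n}}) : A = A' -> label Q2 @: A = label Q2 @: A'.
  by move=> ->.
have class2 x : color_class Q2 c2 x =
    if merged_color c (P |: C) == x
    then label Q2 P |: (color_class Q c x :\: label Q @: (P |: C))
    else color_class Q c x :\: label Q @: (P |: C).
  rewrite classD; have -> : color_class Q2 c2 x = label Q2 @: [set I in Q2 |
      if I == P then merged_color c (P |: C) == x else c I == x].
    by apply: imE; apply/setP => I; rewrite !inE /recolor; case: (I == P).
  case: ifP => mx; last first.
    by apply: imE; apply/setP => I; rewrite !inE; case: (I == P).
  rewrite -imsetU1; apply: imE; apply/setP => I; rewrite !inE.
  by case: eqP => [->|]; rewrite ?PnC ?PQ.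
have subE x : (label Q @: (P |: C) \subset color_class Q c x)
    = [forall I in P |: C, c I == x].
  apply/subsetP/forallP => [h I|h _ /imsetP[I IK ->]].
    by apply/implyP => IK; rewrite -(mem_color_class _ hB hQ) ?KQ // h // imset_f.
  by rewrite (mem_color_class _ hB hQ) ?KQ //; move: (h I); rewrite IK.
have wb : [forall I in P |: C, c I == white_color] ->
    ~~ [forall I in P |: C, c I == black_color].
  move=> /forallP/(_ P); rewrite setU11 => /eqP cP; apply/negP => /forallP/(_ P).
  by rewrite setU11 cP.
rewrite /painted_of_nested !class2 /= !subE; congr Painted.
- congr Forest.
    apply/setP => S; apply/imsetP/imsetP.
      by case=> _ /imsetP[I IQ ->] ->; exists (r I); rewrite ?rQ2 ?muE.
    case=> I IQ2 ->; have IQ := Q2Q IQ2.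
    by exists (label Q I); [apply: imset_f|rewrite muE // rid].
  apply/setP => -[X Y]; apply/imsetP/(@edge_of_nestedP _ _ c2).
    case=> e; rewrite inE => /andP[/(@edge_of_nestedP _ _ c)[I [J [IQ JQ p ->]]]] /=.
    rewrite memC // => nIC [-> ->].
    have IQ2 : I \in Q2.
      rewrite inE IQ andbT; apply: contraNN nIC => IC.
      by rewrite IC (parent_unique JQ PQ p (CP IC)) /=.
    exists I, (r J); rewrite !muE // (rid I) //; split=> //; first exact: rQ2.
    exact: parent_contract.
  case=> I [J [IQ2 JQ2 p [-> ->]]]; have [IQ JQ] := (Q2Q IQ2, Q2Q JQ2).
  have /parentP[IJ _] := p.
  (* The old edge over a given new one starts at the same [I], but ends at the parent of [I] in [Q],
     which may have been removed. *)
  have [J0 J0Q p0] := parent_exists hB hQ IQ JQ IJ.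
  exists (label Q I, label Q J0); last first.
    rewrite /= !muE // (rid I) //; congr (_, label _ _).
    exact: parent_unique JQ2 (rQ2 _ J0Q) p (parent_contract IQ2 J0Q p0).
  rewrite inE /= (edge_of_nested _ hB hQ) // p0 memC //.
  by move: IQ2; rewrite inE => /andP[/negPf->].
all: move: wb; rewrite /merged_color.
all: case: [forall I in P |: C, c I == white_color].
all: by case: [forall I in P |: C, c I == black_color] => // /(_ isT).
Qed.

Lemma paint_grey_of_nested :
  paint_grey N (label Q P) = painted_of_nested Q (recolor c P grey_color).
Proof.
have classE x S : (S \in color_class Q (recolor c P grey_color) x) =
    if S == label Q P then x == grey_color else S \in color_class Q c x.
  apply/(color_classP Q)/idP => [[I [IQ <- ->]]|].
    rewrite /recolor; have [->|neIP] := eqVneq I P; first by rewrite !eqxx.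
    rewrite ifN; first by rewrite (mem_color_class _ hB hQ).
    by apply: contraNneq neIP => /(label_inj hB hQ IQ PQ)->.
  case: eqP => [-> /eqP->|neS /color_classP[I [IQ cI eS]]].
    by exists P; rewrite /recolor eqxx.
  exists I; rewrite /recolor; case: eqP => // eIP; first by case: neS; rewrite eS eIP.
rewrite /paint_grey /painted_of_nested /=; congr Painted.
all: apply/setP => S; rewrite classE !inE; case: eqP => //=.
Qed.

End Contraction.

(** * Coarsening *)

Definition least_above (n : nat) (Q : {set {set 'I_n}}) (I X : {set 'I_n}) : Prop :=
  [/\ X \in Q, I \subset X & {in Q, forall K : {set 'I_n}, I \subset K -> X \subset K}].

(** The flat order on colors, with grey on top and white and black incomparable. *)
Definition color_le (x y : option bool) : bool := (y == grey_color) || (x == y).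

Definition coarsens (n : nat) (Q : {set {set 'I_n}}) (c : {set 'I_n} -> option bool)
    (Q' : {set {set 'I_n}}) (c' : {set 'I_n} -> option bool) : Prop :=
  Q' \subset Q /\
  forall I X, I \in Q -> least_above Q' I X -> color_le (c I) (c' X).

Section LeastAbove.
Variables (n : nat) (Q : {set {set 'I_n}}).
Implicit Types (I J X : {set 'I_n}).

(** [I] lies in the hull of one of its elements [k], and every member containing [I] contains
    [k]. *)
Lemma least_above_exists B I :
  building_set B -> nested B Q -> I \in B -> exists X, least_above Q I X.
Proof.
move=> hB hQ /(building_sub_hull hB hQ)[k kI sI]; exists (hull Q k); split=> //.
  exact: hull_in hB hQ k.
by move=> K KQ /subsetP/(_ k kI); apply: hull_min.
Qed.

Lemma least_above_unique I X Y : least_above Q I X -> least_above Q I Y -> X = Y.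
Proof.
move=> [XQ IX hX] [YQ IY hY]; apply/eqP; rewrite eqEsubset.
by rewrite hX // hY.
Qed.

Lemma least_above_self I : I \in Q -> least_above Q I I.
Proof. by split. Qed.

Lemma least_above_id I X : I \in Q -> least_above Q I X -> X = I.
Proof. by move=> /least_above_self h1 h2; apply: least_above_unique h2 h1. Qed.

(** The way a removed member is pushed upwards: its least surviving superset is that of its
    parent. *)
Lemma least_above_parent (Q' : {set {set 'I_n}}) I P X : Q \subset Q' -> I \notin Q ->
  parent Q' I P -> least_above Q I X -> least_above Q P X.
Proof.
move=> QQ' InQ /parentP[IP hP] [XQ IX hX]; split=> //.
  apply: hP; first exact: subsetP QQ' _ XQ.
  by rewrite properEneq IX andbT; apply: contraNneq InQ => ->.
move=> K KQ PK; apply: hX => //.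
exact: subset_trans (proper_sub IP) PK.
Qed.

End LeastAbove.

Lemma color_le_trans y x z : color_le x y -> color_le y z -> color_le x z.
Proof. by case: x y z => [[]|] [[]|] [[]|]. Qed.

Lemma merged_color_le (n : nat) (c : {set 'I_n} -> option bool) (A : {set {set 'I_n}}) I :
  I \in A -> color_le (c I) (merged_color c A).
Proof.
move=> IA; rewrite /merged_color /color_le; case: ifP => [/forallP/(_ I)|_].
  by rewrite IA => /eqP->.
by case: ifP => [/forallP/(_ I)|//]; rewrite IA => /eqP->.
Qed.

Section Coarsens.
Variables (n : nat) (B : {set {set 'I_n}}).
Hypothesis hB : building_set B.
Implicit Types (Q C : {set {set 'I_n}}) (c : {set 'I_n} -> option bool).
Implicit Types (i j k : 'I_n) (I J K P X : {set 'I_n}).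

Lemma coarsens_eq Q c c' : {in Q, c =1 c'} -> coarsens Q c Q c'.
Proof.
move=> e; split=> // I X IQ /(least_above_id IQ)->.
by rewrite /color_le e // eqxx orbT.
Qed.

Lemma coarsens_refl Q c : coarsens Q c Q c.
Proof. exact: coarsens_eq. Qed.

(** Least members compose: the least member of [Q''] above [I] is also the one above the least
    member of [Q'] above [I]. *)
Lemma coarsens_trans Q' c' Q c Q'' c'' : nested B Q -> nested B Q' ->
  coarsens Q c Q' c' -> coarsens Q' c' Q'' c'' -> coarsens Q c Q'' c''.
Proof.
move=> hQ hQ' [sQ' h] [sQ'' h']; split; first exact: subset_trans sQ'' sQ'.
move=> I X'' IQ [XQ IX hX].
have [X' X'I] := least_above_exists hB hQ' (nested_building hQ IQ).
apply: color_le_trans (h _ _ IQ X'I) _.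
have [X'Q' IX' hX'] := X'I; apply: h' => //; split=> //.
  by apply: hX' => //; apply: subsetP sQ'' _ XQ.
by move=> K KQ X'K; apply: hX => //; apply: subset_trans IX' X'K.
Qed.

Lemma coarsens_antisym Q c Q' c' :
  coarsens Q c Q' c' -> coarsens Q' c' Q c -> Q = Q' /\ {in Q, c =1 c'}.
Proof.
move=> [s1 h1] [s2 h2]; have eQ : Q = Q' by apply/eqP; rewrite eqEsubset s1 s2.
subst Q'; split=> // I IQ.
have := h1 _ _ IQ (least_above_self IQ); have := h2 _ _ IQ (least_above_self IQ).
by case: (c I) (c' I) => [[]|] [[]|].
Qed.

Lemma eq_painted_of_nested Q c c' :
  {in Q, c =1 c'} -> painted_of_nested Q c = painted_of_nested Q c'.
Proof.
move=> e; have ecc x : color_class Q c x = color_class Q c' x.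
  rewrite /color_class; suff -> : [set I in Q | c I == x] = [set I in Q | c' I == x] by [].
  by apply/setP => I; rewrite !inE; case: (boolP (I \in Q)) => //= /e ->.
by rewrite /painted_of_nested !ecc.
Qed.

Lemma painted_of_nested_inj Q c Q' c' : nested B Q -> nested B Q' ->
  painted_of_nested Q c = painted_of_nested Q' c' -> Q = Q' /\ {in Q, c =1 c'}.
Proof.
move=> hQ hQ' e.
have vertsE Q1 c1 : nested B Q1 ->
    nested_of_forest (painted_of_nested Q1 c1) = Q1.
  move=> hQ1; rewrite /nested_of_forest -imset_comp -[RHS]imset_id.
  by apply: eq_in_imset => I /(down_union_of_nested c1 hB hQ1).
have eQ : Q = Q' by rewrite -(vertsE Q c hQ) e vertsE.
subst Q'; split=> // I IQ.
have classE x : (c I == x) = (c' I == x).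
  rewrite -!(mem_color_class _ hB hQ) //.
  by case: x => [[]|]; [have /(congr1 (@black n)) := e|have /(congr1 (@white n)) := e|
    have /(congr1 (@grey n)) := e] => /= ->.
by apply/eqP; rewrite classE.
Qed.

Lemma coarsens_contract Q c P C : P \in Q -> C \subset Q ->
  {in C, forall I : {set 'I_n}, parent Q I P} ->
  coarsens Q c (Q :\: C) (recolor c P (merged_color c (P |: C))).
Proof.
move=> PQ CQ CP; split; first exact: subsetDl.
have PnC : P \notin C by apply/negP => /CP/parentP[]; rewrite properxx.
move=> I X IQ IX; rewrite /recolor.
have [IC|InC] := boolP (I \in C).
  have -> : X = P.
    apply: (@least_above_id _ (Q :\: C)); first by rewrite inE PnC.
    apply: least_above_parent (CP I IC) IX; first exact: subsetDl.
    by rewrite inE IC.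
  by rewrite eqxx merged_color_le // inE IC orbT.
have -> : X = I by apply: least_above_id IX; rewrite inE InC.
case: eqP => [->|_]; first by rewrite merged_color_le // setU11.
by rewrite /color_le eqxx orbT.
Qed.

Lemma coarsens_recolor Q c P : coarsens Q c Q (recolor c P grey_color).
Proof.
split=> // I X IQ /(least_above_id IQ)->; rewrite /recolor /color_le.
by case: (I == P); rewrite ?eqxx ?orbT.
Qed.

Lemma grey_children_of_nested Q c P : nested B Q -> P \in Q ->
  children (painted_of_nested Q c) (label Q P) :&: grey (painted_of_nested Q c)
  = label Q @: [set I in Q | parent Q I P && (c I == grey_color)].
Proof.
move=> hQ PQ; apply/setP => S; rewrite in_setI [_ \in children _ _]in_set.
apply/andP/imsetP => [[/andP[/imsetP[I IQ ->]]]|[I]].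
  rewrite (edge_of_nested _ hB hQ) // (mem_color_class _ hB hQ) // => p cI.
  by exists I; rewrite // in_set IQ p cI.
rewrite in_set => /and3P[IQ p cI] ->.
by rewrite (edge_of_nested _ hB hQ) // (mem_color_class _ hB hQ) // imset_f.
Qed.

(** [B_step] asserts that the result is a painted [B]-forest, and this is where monotonicity of the
    new coloring comes from. *)
Lemma step_coarsens Q c N' : nested B Q ->
  B_step B (painted_of_nested Q c) N' ->
  exists Q' c', [/\ nested B Q', monotone_coloring Q' c',
     N' = painted_of_nested Q' c' & coarsens Q c Q' c'].
Proof.
move=> hQ [[_ vN] vN' sN].
have contractE P (C : {set {set 'I_n}}) : P \in Q -> C \subset Q ->
    {in C, forall I : {set 'I_n}, parent Q I P} ->
    N' = contract (painted_of_nested Q c) (label Q P) (label Q @: C) ->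
  exists Q' c', [/\ nested B Q', monotone_coloring Q' c',
     N' = painted_of_nested Q' c' & coarsens Q c Q' c'].
  move=> PQ CQ CP eN'.
  exists (Q :\: C), (recolor c P (merged_color c (P |: C))).
  have hQ' := nested_contract hQ PQ CP.
  rewrite (contract_of_nested c hB hQ PQ CQ CP) in eN'.
  split=> //; last exact: coarsens_contract.
  by apply/(painted_B_forest_of_nested _ hB hQ'); rewrite -eN'.
have greyE P : P \in Q -> N' = paint_grey (painted_of_nested Q c) (label Q P) ->
  exists Q' c', [/\ nested B Q', monotone_coloring Q' c',
     N' = painted_of_nested Q' c' & coarsens Q c Q' c'].
  move=> PQ; rewrite (paint_grey_of_nested c hB hQ PQ) => eN'.
  exists Q, (recolor c P grey_color); split=> //; last exact: coarsens_recolor.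
  by apply/(painted_B_forest_of_nested _ hB hQ); rewrite -eN'.
case: sN contractE greyE => {N' vN'}.
- move=> T v /(edge_of_nestedP Q)[I [P [IQ PQ p [-> ->]]]] _ contractE _.
  apply: (contractE P [set I]) => //; last by rewrite imset_set1.
    by rewrite sub1set.
  by move=> J /set1P->.
- move=> v /color_classP[P [PQ _ ->]] _ contractE _.
  rewrite (grey_children_of_nested c hQ PQ) in contractE *.
  apply: (contractE P [set I in Q | parent Q I P && (c I == grey_color)]) => //.
    by apply/subsetP => I; rewrite inE => /andP[].
  by move=> I; rewrite inE => /and3P[].
- by move=> v /color_classP[P [PQ _ ->]] _ _ greyE; apply: greyE PQ _.
- by move=> v /color_classP[P [PQ _ ->]] _ _ greyE; apply: greyE PQ _.
Qed.

Lemma painted_ge_coarsens Q c Q' c' : nested B Q -> nested B Q' ->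
  painted_ge B (painted_of_nested Q c) (painted_of_nested Q' c') ->
  coarsens Q c Q' c'.
Proof.
move=> hQ hQ' ge.
(* Generalized over the presentation of the source, because the induction on the closure passes
   through intermediate painted forests that must be presented as colored nested sets in turn. *)
have : forall N N', painted_ge B N N' -> forall Q c, nested B Q ->
    N = painted_of_nested Q c ->
    exists Q' c', [/\ nested B Q', N' = painted_of_nested Q' c' & coarsens Q c Q' c'].
  move=> N N'; elim=> {N N'}.
  - move=> N N' st Q1 c1 hQ1 eN; rewrite eN in st.
    by have [Q2 [c2 [hQ2 _ eN' co]]] := step_coarsens hQ1 st; exists Q2, c2.
  - by move=> N Q1 c1 hQ1 ->; exists Q1, c1; split=> //; apply: coarsens_refl.
  - move=> N1 N2 N3 _ IH1 _ IH2 Q1 c1 hQ1 /(IH1 _ _ hQ1)[Q2 [c2 [hQ2 + co2]]].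
    move=> /(IH2 _ _ hQ2)[Q3 [c3 [hQ3 eN3 co3]]]; exists Q3, c3; split=> //.
    exact: coarsens_trans co2 co3.
move=> /(_ _ _ ge Q c hQ erefl)[Q1 [c1 [hQ1]]].
move=> /(painted_of_nested_inj hQ' hQ1)[eQ ec]; subst Q1 => co.
apply: coarsens_trans co _ => //; apply: coarsens_eq => I IQ.
by rewrite ec.
Qed.

End Coarsens.

(** * Decomposition of a coarsening into moves *)

Definition complexity (n : nat) (Q : {set {set 'I_n}})
    (c : {set 'I_n} -> option bool) : nat :=
  #|Q| + #|[set I in Q | c I != grey_color]|.

Lemma recolor_id (n : nat) (c : {set 'I_n} -> option bool) P : recolor c P (c P) =1 c.
Proof. by move=> I; rewrite /recolor; case: eqP => [->|]. Qed.

(** The hypotheses leave three pairs: both black, both white, and a white child of a grey parent. In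
    each the merged color is that of the parent, so contracting the edge deletes [J] and recolors
    nothing. *)
Lemma merged_color_pair (n : nat) (c : {set 'I_n} -> option bool) (P J : {set 'I_n}) :
  (c J == white_color) || (c P == black_color) ->
  (c J == black_color) || (c P != black_color) ->
  merged_color c (P |: [set J]) = c P.
Proof.
have h x : [forall I in P |: [set J], c I == x] = (c P == x) && (c J == x).
  apply/forallP/andP => [h|[cP cJ] I].
    by split; [have := h P|have := h J]; rewrite !inE eqxx ?orbT.
  by rewrite !inE; apply/implyP => /orP[] /eqP->.
by rewrite /merged_color !h; case: (c J) (c P) => [[]|] [[]|].
Qed.

Section CoarsensStep.
Variables (n : nat) (B Q Q' : {set {set 'I_n}}) (c c' : {set 'I_n} -> option bool).
Hypotheses (hB : building_set B) (hQ : nested B Q) (hQ' : nested B Q').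
Hypotheses (mc : monotone_coloring Q c) (mc' : monotone_coloring Q' c').
Hypothesis co : coarsens Q c Q' c'.
Implicit Types (I J K P X : {set 'I_n}).
Local Notation N := (painted_of_nested Q c).

(** The unit of the induction on [complexity]: a contraction shrinks [Q] and creates no new non-grey
    member, while painting grey keeps [Q] and loses a non-grey member. *)
Definition next_step : Prop :=
  exists Q2 c2, [/\ nested B Q2, monotone_coloring Q2 c2,
    B_step B N (painted_of_nested Q2 c2), coarsens Q2 c2 Q' c' &
    complexity Q2 c2 < complexity Q c].

Let Q'Q I : I \in Q' -> I \in Q. Proof. by case: co => /subsetP h _; apply: h. Qed.

Let color_co I X : I \in Q -> least_above Q' I X -> color_le (c I) (c' X).
Proof. by case: co => _; apply. Qed.

Let color_co_self I : I \in Q' -> color_le (c I) (c' I).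
Proof. by move=> IQ'; apply: color_co (Q'Q IQ') (least_above_self IQ'). Qed.

Let above_exists I : I \in Q -> exists X, least_above Q' I X.
Proof. by move=> /(nested_building hQ); apply: least_above_exists hB hQ'. Qed.

Let parent_removed J : J \in Q -> J \notin Q' -> exists2 P, P \in Q & parent Q J P.
Proof.
move=> JQ JQ'; have [X [XQ' JX _]] := above_exists JQ.
apply: (parent_exists hB hQ JQ (Q'Q XQ')); rewrite properEneq JX andbT.
by apply: contraNneq JQ' => ->.
Qed.

(** Only the color of [P] can change, so the comparison with the target has to be checked again at
    [P] alone; this is the last hypothesis. *)
Lemma contract_next_step P (C : {set {set 'I_n}}) : P \in Q -> C \subset Q ->
  {in C, forall I, parent Q I P} -> C != set0 -> Q' \subset Q :\: C ->
  monotone_coloring (Q :\: C) (recolor c P (merged_color c (P |: C))) ->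
  step N (contract N (label Q P) (label Q @: C)) ->
  (forall X, least_above Q' P X -> color_le (merged_color c (P |: C)) (c' X)) ->
  next_step.
Proof.
move=> PQ CQ CP C0 sQ' m2 st hX.
have hQ2 := nested_contract hQ PQ CP.
exists (Q :\: C), (recolor c P (merged_color c (P |: C))); split=> //.
- rewrite -(contract_of_nested c hB hQ PQ CQ CP); split=> //.
    by apply/(painted_B_forest_of_nested c hB hQ).
  rewrite (contract_of_nested c hB hQ PQ CQ CP).
  by apply/(painted_B_forest_of_nested _ hB hQ2).
- split=> // I X; rewrite inE => /andP[_ IQ] IX; rewrite /recolor.
  case: eqP => [eI|_]; last exact: color_co.
  by rewrite eI in IX; apply: hX.
- rewrite /complexity -addSn leq_add //.
    rewrite proper_card // properEneq subsetDl andbT.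
    have /set0Pn[I IC] := C0; apply/eqP => /setP/(_ I).
    by rewrite inE IC (subsetP CQ _ IC).
  apply: subset_leq_card; apply/subsetP => I; rewrite !inE => /andP[/andP[_ ->]].
  rewrite /recolor /=; case: (eqVneq I P) => [->|//].
  have := @merged_color_le _ c (P |: C) P (setU11 _ _).
  by case: (merged_color _ _) (c P) => [[]|] [[]|].
Qed.

(** White below and black above is what monotonicity demands around a grey member. *)
Lemma grey_next_step P X : P \in Q -> c P != grey_color ->
  least_above Q' P X -> c' X = grey_color ->
  {in Q, forall I, I \proper P -> c I = white_color} ->
  {in Q, forall K, P \proper K -> c K = black_color} ->
  step N (paint_grey N (label Q P)) -> next_step.
Proof.
move=> PQ cP PX cX lo up st.
have m2 : monotone_coloring Q (recolor c P grey_color).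
  move=> I K IQ KQ IK; rewrite /recolor.
  case: (eqVneq I P) IK => [->|neI]; case: (eqVneq K P) => [->|neK].
  - by rewrite properxx.
  - by move=> /up->.
  - by move=> /lo->.
  - exact: mc.
exists Q, (recolor c P grey_color); split=> //.
- rewrite -(paint_grey_of_nested c hB hQ PQ); split=> //.
    by apply/(painted_B_forest_of_nested c hB hQ).
  rewrite (paint_grey_of_nested c hB hQ PQ).
  by apply/(painted_B_forest_of_nested _ hB hQ).
- split=> [|I Y IQ IY]; first by case: co.
  rewrite /recolor; case: eqP => [eI|_]; last exact: color_co.
  by rewrite eI in IY; rewrite (least_above_unique IY PX) cX.
- rewrite /complexity ltn_add2l proper_card // properE; apply/andP; split.
    apply/subsetP => I; rewrite !inE /recolor => /andP[->].
    by case: (eqVneq I P).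
  apply/subsetPn; exists P; first by rewrite inE PQ.
  by rewrite inE /recolor eqxx andbF.
Qed.

Lemma white_next_step P X : P \in Q -> c P = white_color ->
  least_above Q' P X -> c' X = grey_color ->
  {in Q, forall K, P \proper K -> c K = black_color} -> next_step.
Proof.
move=> PQ cP PX cX up; apply: (grey_next_step PQ _ PX cX _ up).
- by rewrite cP.
- by move=> I IQ IP; have /orP[/eqP//|] := mc IQ PQ IP; rewrite cP.
apply: step_white_grey; first by rewrite (mem_color_class _ hB hQ) // cP.
move=> _ /(edge_of_nestedP Q)[I [K [IQ KQ p [eP ->]]]].
rewrite -(label_inj hB hQ PQ IQ eP) in p; have /parentP[PK _] := p.
by rewrite (mem_color_class _ hB hQ) // up.
Qed.

(** Below a grey [P] the target is white, and a color of the target other than grey is already the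
    color in [Q]. So all children of [P] are white and the move is legal. *)
Lemma black_next_step P : P \in Q -> c P = black_color ->
  P \in Q' -> c' P = grey_color -> Q = Q' -> next_step.
Proof.
move=> PQ cP PQ' cP' eQ.
have lo : {in Q, forall I, I \proper P -> c I = white_color}.
  move=> I; rewrite eQ => IQ' IP; have := mc' IQ' PQ' IP; rewrite cP' orbF.
  by move=> /eqP cI; have := color_co_self IQ'; rewrite cI /color_le /= => /eqP.
apply: (grey_next_step PQ _ (least_above_self PQ') cP' lo).
- by rewrite cP.
- by move=> K KQ PK; have := mc PQ KQ PK; rewrite cP => /eqP.
apply: step_black_grey; first by rewrite (mem_color_class _ hB hQ) // cP.
apply/subsetP => S; rewrite in_set => /andP[/imsetP[I IQ ->]].
rewrite (edge_of_nested _ hB hQ) // (mem_color_class _ hB hQ) //.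
by case/parentP => /(lo I IQ)->.
Qed.

Lemma edge_next_step J P : J \in Q -> J \notin Q' -> P \in Q -> parent Q J P ->
  (c J == black_color) || (c P != black_color) -> next_step.
Proof.
move=> JQ JQ' PQ p hc; have /parentP[JP _] := p.
have hc' := mc JQ PQ JP.
have eM := merged_color_pair hc' hc.
apply: (@contract_next_step P [set J]) => //.
- by rewrite sub1set.
- by move=> I /set1P->.
- by apply/set0Pn; exists J; rewrite inE.
- by rewrite subsetD1 JQ' andbT; case: co.
- rewrite eM => I K; rewrite !inE => /andP[_ IQ] /andP[_ KQ] IK.
  by rewrite !recolor_id; apply: mc.
- rewrite imset_set1; apply: step_edge; first by rewrite (edge_of_nested _ hB hQ).
  rewrite !(mem_color_class _ hB hQ) //.
  move: hc hc'; case: (c J) (c P) => [[]|] [[]|] //= _ _.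
  + exact: Or41.
  + exact: Or42.
  + exact: Or43.
- by move=> X PX; rewrite eM; apply: color_co.
Qed.

(* When every member of [Q] missing from [Q'] is grey and has a black parent, the
   least member of [Q'] above such a parent [P] must be grey; then every member of
   [Q] strictly below [P] is white or a grey child of [P]. *)
Lemma bunch_next_step J : J \in Q -> J \notin Q' ->
  {in Q, forall I, I \notin Q' -> c I = grey_color} ->
  {in Q &, forall I P, I \notin Q' -> parent Q I P -> c P = black_color} ->
  next_step.
Proof.
move=> JQ JQ' hg hb; have [P PQ p] := parent_removed JQ JQ'.
have cP := hb J P JQ PQ JQ' p; have cJ := hg J JQ JQ'.
(* Members missing from [Q'] are grey, whereas [P] is black. *)
have PQ' : P \in Q' by apply/negPn/negP => /(hg P PQ); rewrite cP.
have cP' : c' P = grey_color.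
  have [X JX] := above_exists JQ.
  have eX : X = P.
    apply: (least_above_id PQ'); apply: least_above_parent p JX => //.
    by case: co.
  by have := color_co JQ JX; rewrite eX cJ /color_le eq_sym orbb => /eqP.
have lo I : I \in Q' -> I \proper P -> c I = white_color.
  move=> IQ' IP; have := mc' IQ' PQ' IP; rewrite cP' orbF => /eqP cI.
  by have := color_co_self IQ'; rewrite cI /color_le /= => /eqP.
pose C := [set I in Q | parent Q I P && (c I == grey_color)].
have JC : J \in C by rewrite inE JQ p cJ.
have CE I : I \in C -> [/\ I \in Q, parent Q I P & c I = grey_color].
  by rewrite inE => /and3P[IQ pI /eqP cI].
have CnQ' I : I \in C -> I \notin Q'.
  move=> /CE[IQ /parentP[IP _] cI]; apply/negP => /lo/(_ IP).
  by rewrite cI.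
(* A removed [I] strictly below [P] has a black parent [R] inside [P], and [R] survives. If [R] were
   strictly below [P] it would be white; so [R = P] and [I] is in the bunch. *)
have loC I : I \in Q -> I \notin C -> I \proper P -> c I = white_color.
  move=> IQ InC IP; have [/lo->//|InQ'] := boolP (I \in Q').
  have [R RQ pR] := parent_removed IQ InQ'; have cR := hb I R IQ RQ InQ' pR.
  have /parentP[IR /(_ P PQ IP) RP] := pR.
  have RQ' : R \in Q' by apply/negPn/negP => /(hg R RQ); rewrite cR.
  have [eR|neR] := eqVneq R P.
    by rewrite eR in pR; rewrite inE IQ pR hg in InC.
  have : R \proper P by rewrite properEneq neR.
  by move/(lo R RQ'); rewrite cR.
have eM : merged_color c (P |: C) = grey_color.
  have := @merged_color_le _ c (P |: C) P (setU11 _ _).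
  have := @merged_color_le _ c (P |: C) J.
  rewrite inE JC orbT cP cJ => /(_ isT).
  by case: (merged_color _ _) => [[]|].
apply: (@contract_next_step P C) => //.
- by apply/subsetP => I /CE[].
- by move=> I /CE[].
- by apply/set0Pn; exists J.
- apply/subsetP => I IQ'; rewrite inE Q'Q // andbT.
  by apply: contraTN IQ' => /CnQ'.
- rewrite eM => I K; rewrite !inE => /andP[InC IQ] /andP[_ KQ] IK; rewrite /recolor.
  case: (eqVneq I P) IK => [->|neI]; case: (eqVneq K P) => [->|neK].
  + by rewrite properxx.
  + by move=> PK; have := mc PQ KQ PK; rewrite cP.
  + by move=> IP; rewrite loC // inE.
  + exact: mc.
- have gE := grey_children_of_nested hB c hQ PQ.
  rewrite -gE; apply: step_bunch; first by rewrite (mem_color_class _ hB hQ) // cP.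
  by rewrite gE; apply/set0Pn; exists (label Q J); apply: imset_f.
- by move=> X /(least_above_id PQ')->; rewrite cP'.
Qed.

(** The cases are ordered so that each failure supplies the hypotheses of the next. If no single
    edge above a removed member can be contracted, removed members are non-black with black parents;
    white ones can be painted grey, and if there are none, a bunch can be contracted. If nothing is
    to be removed, only colors differ, and a color that differs is grey in the target. *)
Lemma coarsens_next_step : (Q = Q' /\ {in Q, c =1 c'}) \/ next_step.
Proof.
have [|h1] := boolP [exists J in Q, exists P in Q,
    [&& J \notin Q', parent Q J P & (c J == black_color) || (c P != black_color)]].
  case/existsP => J /andP[JQ /existsP[P /and4P[PQ JQ' p hc]]].
  by right; apply: edge_next_step p hc.
have hedge J P : J \in Q -> J \notin Q' -> P \in Q -> parent Q J P ->
    c J != black_color /\ c P = black_color.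
  move=> JQ JQ' PQ p; move: h1; rewrite negb_exists => /forallP/(_ J).
  rewrite JQ negb_exists => /forallP/(_ P).
  by rewrite PQ JQ' p negb_or negbK => /andP[? /eqP].
have [|h2] := boolP [exists J in Q, (J \notin Q') && (c J == white_color)].
  case/existsP => J /and3P[JQ JQ' /eqP cJ]; right.
  have [P PQ p] := parent_removed JQ JQ'.
  have [_ cP] := hedge J P JQ JQ' PQ p.
  have [X JX] := above_exists JQ.
  (* [X] is the least member above both the white [J] and its black parent [P], so its target color
     dominates white and black and must be grey. *)
  apply: (white_next_step JQ cJ JX).
    have PX : least_above Q' P X by apply: least_above_parent p JX => //; case: co.
    have := color_co JQ JX; have := color_co PQ PX; rewrite cJ cP.
    by case: (c' X) => [[]|].
  have /parentP[_ hP] := p; move=> K KQ /(hP K KQ) PK.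
  have [<-//|nePK] := eqVneq P K.
  have : P \proper K by rewrite properEneq nePK.
  by move/(mc PQ KQ); rewrite cP => /eqP.
have hg : {in Q, forall I, I \notin Q' -> c I = grey_color}.
  move=> J JQ JQ'; have [P PQ p] := parent_removed JQ JQ'.
  have [cJ _] := hedge J P JQ JQ' PQ p.
  move: h2; rewrite negb_exists => /forallP/(_ J); rewrite JQ JQ' /=.
  by case: (c J) cJ => [[]|].
have [sQ|/subsetPn[J JQ JQ']] := boolP (Q \subset Q'); last first.
  right; apply: bunch_next_step JQ JQ' hg _.
  by move=> I P IQ PQ IQ' p; have [] := hedge I P IQ IQ' PQ p.
have eQ : Q = Q' by apply/eqP; rewrite eqEsubset sQ; case: co.
have [/existsP[J /andP[JQ neJ]]|h3] := boolP [exists J in Q, c J != c' J]; last first.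
  left; split=> // J JQ; apply/eqP; move: h3; rewrite negb_exists => /forallP/(_ J).
  by rewrite JQ /= negbK.
have JQ' : J \in Q' by rewrite -eQ.
have := color_co_self JQ'; rewrite /color_le (negPf neJ) orbF => /eqP cJ'.
right; case cJ : (c J) => [[]|]; first exact: (black_next_step JQ cJ JQ' cJ' eQ).
  apply: (white_next_step JQ cJ (least_above_self JQ') cJ').
  move=> K; rewrite eQ => KQ' JK; have := mc' JQ' KQ' JK; rewrite cJ' /= => /eqP cK'.
  by have := color_co_self KQ'; rewrite cK' /color_le /= => /eqP.
by rewrite cJ cJ' in neJ.
Qed.

End CoarsensStep.

Lemma coarsens_painted_ge (n : nat) (B Q Q' : {set {set 'I_n}})
    (c c' : {set 'I_n} -> option bool) :
  building_set B -> nested B Q -> nested B Q' ->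
  monotone_coloring Q c -> monotone_coloring Q' c' -> coarsens Q c Q' c' ->
  painted_ge B (painted_of_nested Q c) (painted_of_nested Q' c').
Proof.
move=> hB hQ hQ' mc mc' co.
have [m] := ubnP (complexity Q c); elim: m Q c hQ mc co => // m IH Q c hQ mc co.
rewrite ltnS => lem.
case: (coarsens_next_step hB hQ hQ' mc mc' co) => [[eQ ec]|].
  by subst Q'; rewrite (eq_painted_of_nested ec); apply: rt_refl.
case=> Q2 [c2 [hQ2 mc2 st co2 lt2]].
apply: rt_trans (rt_step _ _ _ _ st) _; apply: IH => //.
exact: leq_trans lt2 lem.
Qed.

Import Order.TTheory GRing.Theory Num.Theory.
Local Open Scope ring_scope.

(** * Colored nested sets from vectors *)

(* The members of [B] that are maximal in [B] among the subsets of some sublevel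
   set [[set i | y i <= a]]. *)
Definition level_sets (R : realDomainType) (n : nat) (B : {set {set 'I_n}})
    (y : 'I_n -> R) : {set {set 'I_n}} :=
  [set I in B | [forall J in B, (I \proper J) ==>
     [exists j in J, [forall i in I, y i < y j]]]].

Definition level_color (R : realDomainType) (n : nat) (y : 'I_n -> R) (t : R)
    (I : {set 'I_n}) : option bool :=
  if [forall i in I, y i < t] then white_color
  else if [exists i in I, t < y i] then black_color else grey_color.

(* [argmax_sub B y t z s]: on every [I] in [B] and every [I] with the extra point
   added, the maximizers of [(y, t)] are among those of [(z, s)]. *)
Definition argmax_sub (R : realDomainType) (n : nat) (B : {set {set 'I_n}})
    (y : 'I_n -> R) (t : R) (z : 'I_n -> R) (s : R) : Prop :=
  forall I : {set 'I_n}, I \in B ->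
  [/\ {in I, forall i, {in I, forall j, y j <= y i} -> {in I, forall j, z j <= z i}},
      {in I, forall i, {in I, forall j, y j <= y i} -> t <= y i -> s <= z i} &
      {in I, forall j, y j <= t} -> {in I, forall j, z j <= s}].

Section Levels.
Variables (R : realDomainType) (n : nat) (B : {set {set 'I_n}}).
Hypothesis hB : building_set B.
Implicit Types (i j k : 'I_n) (I J K P X : {set 'I_n}) (y z : 'I_n -> R) (s t : R).

Lemma level_setsP y I :
  reflect (I \in B /\ {in B, forall J, I \proper J ->
             exists2 j, j \in J & {in I, forall i, y i < y j}})
          (I \in level_sets B y).
Proof.
rewrite inE; apply: (iffP andP) => -[IB h]; split=> //.
  move=> J JB IJ; move/forallP: h => /(_ J); rewrite JB IJ /=.
  case/existsP => j /andP[jJ /forallP hj]; exists j => // i iI.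
  by move: (hj i); rewrite iI.
apply/forallP => J; apply/implyP => JB; apply/implyP => /(h J JB)[j jJ hj].
apply/existsP; exists j; rewrite jJ /=; apply/forallP => i; apply/implyP; exact: hj.
Qed.

Lemma level_color_whiteP y t I :
  reflect {in I, forall i, y i < t} (level_color y t I == white_color).
Proof.
rewrite /level_color; case: ifPn => [h|h].
  by apply: (iffP eqP) => // _ i iI; move/forallP: h => /(_ i); rewrite iI.
case: ifP => _; apply: (iffP eqP) => // a; case/negP: h.
all: by apply/forallP => i; apply/implyP; apply: a.
Qed.

Lemma level_color_blackP y t I :
  reflect (exists2 i, i \in I & t < y i) (level_color y t I == black_color).
Proof.
rewrite /level_color; apply: (iffP idP) => [|[i iI ti]].
  by case: ifP => // _; case: ifP => // /existsP[i /andP[iI ti]] _; exists i.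
rewrite ifN; last by apply/forallPn; exists i; rewrite iI /= -leNgt ltW.
by rewrite ifT //; apply/existsP; exists i; rewrite iI.
Qed.

Lemma level_color_eq y t I J : I \subset J ->
  {in J, forall j, exists2 i, i \in I & y j <= y i} ->
  level_color y t J = level_color y t I.
Proof.
move=> IJ h.
have ew : (level_color y t J == white_color) = (level_color y t I == white_color).
  apply/level_color_whiteP/level_color_whiteP => a i.
    by move=> /(subsetP IJ); apply: a.
  by move=> /h[j jI ij]; apply: le_lt_trans ij _; apply: a.
have eb : (level_color y t J == black_color) = (level_color y t I == black_color).
  apply/level_color_blackP/level_color_blackP => -[i iI ti].
    by have [j jI ij] := h i iI; exists j => //; apply: lt_le_trans ij.
  by exists i => //; apply: subsetP IJ _ iI.
by move: ew eb; case: (level_color y t J) (level_color y t I) => [[]|] [[]|].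
Qed.

(** [H] is a maximal element of [B] around [J] on which [y] does not exceed its maximum on [J]. It
    is least: if a level set [K] contains [J] but not [H], then [H :|: K] is in [B] and has an
    element higher than all of [K]; it lies in [H], yet there it is bounded by a value on [J], which
    is inside [K]. *)
Lemma level_above y J : J \in B ->
  exists2 H, least_above (level_sets B y) J H &
    {in H, forall h, exists2 j, j \in J & y h <= y j}.
Proof.
move=> JB.
pose p H := [&& H \in B, J \subset H & [forall h in H, exists j in J, y h <= y j]].
have pP H : reflect [/\ H \in B, J \subset H &
    {in H, forall h, exists2 j, j \in J & y h <= y j}] (p H).
  apply: (iffP and3P) => -[HB JH h]; split=> //.
    move=> i iH; move/forallP: h => /(_ i); rewrite iH => /existsP[j /andP[jJ ij]].
    by exists j.
  apply/forallP => i; apply/implyP => /h[j jJ ij]; apply/existsP; exists j.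
  by rewrite jJ.
have pJ : p J by apply/pP; split=> // j jJ; exists j.
have [H mH JH] := @maxset_exists _ p J pJ.
have /pP[HB _ hH] := maxsetp mH.
exists H => //; split=> //.
  apply/level_setsP; split=> // K KB HK.
  have : ~~ p K.
    by apply/negP => /(maxsetsup mH)/(_ (proper_sub HK)) eK; rewrite eK properxx in HK.
  rewrite /p KB (subset_trans JH (proper_sub HK)) /= => /forallPn[k].
  rewrite negb_imply => /andP[kK]; rewrite negb_exists => /forallP hk.
  exists k => // i /hH[j jJ ij]; apply: le_lt_trans ij _; rewrite ltNge.
  by move: (hk j); rewrite jJ.
move=> K /level_setsP[KB hK] JK; apply/negPn/negP => nHK.
have /set0Pn[j0 j0J] := building_neq0 hB JB.
have UB : H :|: K \in B.
  by apply: (building_setU hB HB KB (subsetP JH _ j0J)); apply: subsetP JK _ j0J.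
have KU : K \proper H :|: K.
  rewrite properE subsetUr /=; apply: contraNN nHK; apply: subset_trans.
  exact: subsetUl.
have [j jU hj] := hK _ UB KU.
have [jK|jnK] := boolP (j \in K); first by have := hj j jK; rewrite ltxx.
have jH : j \in H by move: jU; rewrite inE (negPf jnK) orbF.
have [k kJ jk] := hH j jH; have := hj k (subsetP JK _ kJ).
by rewrite ltNge jk.
Qed.

(** Passing to the least level set does not change the maximum of [y], so colors on the nested set
    record the comparison with [t] for every [J] in [B]. *)
Lemma level_above_color y t J H : J \in B -> least_above (level_sets B y) J H ->
  level_color y t H = level_color y t J.
Proof.
move=> JB JH; have [H' JH' hH'] := level_above y JB.
rewrite (least_above_unique JH JH'); apply: level_color_eq => //.
by case: JH'.
Qed.

Lemma argmax_exists y I : I != set0 -> exists2 i, i \in I & {in I, forall j, y j <= y i}.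
Proof.
case/set0Pn => i0 i0I; case: (@arg_maxP _ _ _ i0 (fun i => i \in I) y i0I) => i iI h.
by exists i.
Qed.

(** If the union of an antichain were in [B], the member where [y] attains its maximum on the union
    would have to be exceeded inside the union. *)
Lemma nested_level_sets y : nested B (level_sets B y).
Proof.
split.
- by apply/subsetP => I /level_setsP[].
- move=> Z ZL Z1 hZ; apply/negP => UB.
  have [i /bigcupP[I IZ iI] hi] := argmax_exists y (building_neq0 hB UB).
  have /level_setsP[_ hI] := subsetP ZL I IZ.
  have [|j jU hj] := hI _ UB.
    rewrite properEneq bigcup_sup // andbT; apply/eqP => eI.
    have /subsetPn[J JZ] : ~~ (Z \subset [set I]).
      by apply: contraTN Z1 => /subset_leq_card; rewrite cards1 -leqNgt.
    rewrite inE => neJI.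
    have := hZ J I JZ IZ neJI; rewrite eI => /negP; apply.
    exact: bigcup_sup.
  by have := hi j jU; rewrite leNgt hj.
- move=> I mI; apply/level_setsP; split; first exact: maxsetp mI.
  move=> J JB IJ; have := maxsetsup mI JB (proper_sub IJ) => eJ.
  by rewrite eJ properxx in IJ.
Qed.

(** Some [y j] with [j] in [J] exceeds all values on [I]; whichever side of [t] it falls on settles
    one of the two alternatives. *)
Lemma monotone_level_color y t : monotone_coloring (level_sets B y) (level_color y t).
Proof.
move=> I J /level_setsP[IB hI] /level_setsP[JB _] IJ.
have [j jJ hj] := hI J JB IJ.
apply/orP; have [jt|tj] := leP (y j) t; [left|right].
  by apply/level_color_whiteP => i iI; apply: lt_le_trans (hj i iI) jt.
by apply/level_color_blackP; exists j.
Qed.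

Lemma argmax_sub_coarsens y t z s :
  argmax_sub B y t z s <->
  coarsens (level_sets B y) (level_color y t) (level_sets B z) (level_color z s).
Proof.
split=> [h|[sub hc]].
  split.
    apply/subsetP => I /level_setsP[IB hI]; apply/level_setsP; split=> // J JB IJ.
    have [j jJ hj] := hI J JB IJ.
    (* The [y]-maximizer [k] of [J] is also a [z]-maximizer. An [i] in [I] with [y i = y k] would be
       one too, although [z i < z j]. *)
    have [k kJ hk] := argmax_exists y (building_neq0 hB JB).
    have [hJ _ _] := h J JB.
    have zjk : z j <= z k by apply: hJ.
    exists k => // i iI; have iJ := subsetP (proper_sub IJ) i iI.
    rewrite lt_neqAle hk // andbT; apply/eqP => eik.
    have : z k <= z i by apply: (hJ i iJ) => // l lJ; rewrite eik; apply: hk.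
    by rewrite leNgt (lt_le_trans (hj i iI) zjk).
  move=> I X /level_setsP[IB _] /(level_above_color s IB)->.
  have [h1 h2 h3] := h I IB; have [k kI hk] := argmax_exists y (building_neq0 hB IB).
  rewrite /color_le.
  (* On [I] with the extra point, white means that only the extra point is maximal, black that it is
     not maximal, and grey that it ties with elements of [I]. *)
  have w_nb : level_color y t I == white_color -> level_color z s I != black_color.
    move/level_color_whiteP => hw; apply/level_color_blackP => -[i iI].
    by rewrite ltNge h3 // => j /hw/ltW.
  have b_nw : level_color y t I == black_color -> level_color z s I != white_color.
    move/level_color_blackP => [i iI ti]; apply/level_color_whiteP => /(_ k kI).
    by rewrite ltNge h2 // (le_trans (ltW ti)) // hk.
  have g_g : level_color y t I == grey_color -> level_color z s I == grey_color.
    move/eqP => cg.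
    have nw : ~~ (level_color y t I == white_color) by rewrite cg.
    have nb : ~~ (level_color y t I == black_color) by rewrite cg.
    have jt j : j \in I -> y j <= t.
      by move=> jI; rewrite leNgt; apply: contraNN nb => tj; apply/level_color_blackP; exists j.
    have tk : t <= y k.
      rewrite leNgt; apply: contraNN nw => kt; apply/level_color_whiteP => i iI.
      exact: le_lt_trans (hk i iI) kt.
    have : level_color z s I != white_color.
      by apply/level_color_whiteP => /(_ k kI); rewrite ltNge h2.
    have : level_color z s I != black_color.
      by apply/level_color_blackP => -[i iI]; rewrite ltNge h3.
    by case: (level_color z s I) => [[]|].
  move: w_nb b_nw g_g.
  by case: (level_color y t I) (level_color z s I) => [[]|] [[]|] //= a b d;
    solve [have := a isT; done | have := b isT; done | have := d isT; done].
(* The comparison extends from level sets to all of [B]: the least level set [X] of [z] above [I] is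
   also the least one above [H], the least level set of [y] above [I]. *)
have hcol I : I \in B -> color_le (level_color y t I) (level_color z s I).
  move=> IB; have [H IH _] := level_above y IB; have [X IX _] := level_above z IB.
  have [HL sIH hH] := IH; have [XL sIX hX] := IX.
  rewrite -(level_above_color t IB IH) -(level_above_color s IB IX).
  apply: hc => //; split=> //; first by apply: hH => //; apply: subsetP sub _ XL.
  by move=> K KL HK; apply: hX => //; apply: subset_trans sIH HK.
have hmax I : I \in B -> {in I, forall i, {in I, forall j, y j <= y i} ->
    {in I, forall j, z j <= z i}}.
  move=> IB i iI hi j jI.
  have iB : [set i] \in B by case: hB.
  (* [H] is the least level set of [z] containing [i], and [z] is at most [z i] on it. It is a level
     set of [y] as well, so if [I] were not inside [H], the set [H :|: I] would have an element
     higher for [y] than all of [H]. That element is in [I] and exceeds the maximizer [i]. *)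
  have [H [HL + _] hH] := level_above z iB; rewrite sub1set => iH.
  have zH h : h \in H -> z h <= z i by move=> /hH[k /set1P->].
  apply: zH; apply/negPn/negP => jnH.
  have /level_setsP[HB hHy] := subsetP sub _ HL.
  have UB : H :|: I \in B by apply: (building_setU hB HB IB iH iI).
  have [|k kU hk] := hHy _ UB.
    by rewrite properE subsetUl /=; apply/subsetPn; exists j => //; rewrite inE jI orbT.
  have [kH|knH] := boolP (k \in H); first by have := hk k kH; rewrite ltxx.
  have kI : k \in I by move: kU; rewrite inE (negPf knH).
  by have := hk i iH; rewrite ltNge hi.
move=> I IB; split; first exact: hmax.
- move=> i iI hi ti; have hzi := hmax I IB i iI hi.
  have nw : level_color y t I != white_color.
    by apply/level_color_whiteP => /(_ i iI); rewrite ltNge ti.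
  have : level_color z s I != white_color.
    by move: (hcol I IB) nw; case: (level_color y t I) (level_color z s I) => [[]|] [[]|].
  rewrite leNgt; apply: contraNN => zis; apply/level_color_whiteP => j jI.
  exact: le_lt_trans (hzi j jI) zis.
- move=> hyt j jI.
  have nb : level_color y t I != black_color.
    by apply/level_color_blackP => -[i iI]; rewrite ltNge hyt.
  have : level_color z s I != black_color.
    by move: (hcol I IB) nb; case: (level_color y t I) (level_color z s I) => [[]|] [[]|].
  by rewrite leNgt; apply: contraNN => sj; apply/level_color_blackP; exists j.
Qed.

(** * Realization of colored nested sets by vectors *)

Definition height (c : {set 'I_n} -> option bool) I : int :=
  match c I with
  | Some true => #|I|%:Z
  | Some false => #|I|%:Z - n.+1%:Z
  | None => 0
  end.

(** Within one color the cardinality decides. Across colors the signs do: the shift by [n.+1] makes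
    white heights negative since [I] has at most [n] elements, and black heights are positive since
    [I] is nonempty. *)
Lemma height_lt Q c I J : nested B Q -> monotone_coloring Q c ->
  I \in Q -> J \in Q -> I \proper J -> height c I < height c J.
Proof.
move=> hQ mc IQ JQ IJ; have := mc I J IQ JQ IJ.
have lt1 : (#|I|%:Z < #|J|%:Z :> int) by rewrite ltz_nat proper_card.
have lt0 : (0 < #|J|%:Z :> int).
  by rewrite ltz_nat card_gt0 (building_neq0 hB) // (nested_building hQ).
have ltI : (#|I|%:Z - n.+1%:Z < 0 :> int).
  by rewrite subr_lt0 ltz_nat ltnS -[X in (_ <= X)%N]card_ord max_card.
rewrite /height; case: (c I) (c J) => [[]|] [[]|] //= _.
- exact: lt_trans ltI lt0.
- by rewrite ltrD2r.
Qed.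

(** [y i] is the height of the hull of [i], so the maximum of [y] on a member of [Q] is its height,
    attained on its label, and its sign gives the color for the threshold 0. A level set of [y] lies
    in the hull of one of its elements [k]; as [y] is at most [y k] on that hull, the inclusion
    cannot be proper. *)
Lemma level_realization Q c : nested B Q -> monotone_coloring Q c ->
  exists y t, level_sets B y = Q /\ {in Q, level_color y t =1 c}.
Proof.
move=> hQ mc; pose g I : R := (height c I)%:~R.
have g_lt I J : I \in Q -> J \in Q -> I \proper J -> g I < g J.
  by move=> IQ JQ IJ; rewrite ltr_int (height_lt hQ mc).
have g_le I J : I \in Q -> J \in Q -> I \subset J -> g I <= g J.
  by move=> IQ JQ; rewrite subEproper => /orP[/eqP->//|/(g_lt _ _ IQ JQ)/ltW].
have hin := hull_in hB hQ.
pose y i := g (hull Q i).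
have y_le I i : I \in Q -> i \in I -> y i <= g I.
  by move=> IQ iI; apply: g_le => //; apply: hull_min.
have y_max I : I \in Q -> exists2 i, i \in I & y i = g I.
  move=> IQ; have /set0Pn[i iI] := label_neq0 hB hQ IQ.
  exists i; first exact: subsetP (label_sub _ _) _ iI.
  by rewrite /y (label_hull IQ iI).
exists y, 0; split.
  apply/setP => I; apply/level_setsP/idP => [[IB hI]|IQ].
    have [k kI sI] := building_sub_hull hB hQ IB.
    suff -> : I = hull Q k by apply: hin.
    apply/eqP; apply/negPn/negP => neI.
    have [|j jH hj] := hI _ (nested_building hQ (hin k)).
      by rewrite properEneq neI.
    by have := hj k kI; rewrite ltNge y_le.
  split=> [|J JB IJ]; first exact: (nested_building hQ).
  have [k kJ sJ] := building_sub_hull hB hQ JB; exists k => // i iI.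
  apply: le_lt_trans (y_le I i IQ iI) _; apply: g_lt => //.
  exact: proper_sub_trans IJ sJ.
move=> I IQ; have [k kI yk] := y_max I IQ.
have c0 : (0 < #|I|)%N by rewrite card_gt0 (building_neq0 hB) // (nested_building hQ).
have gw : (g I < 0) = (c I == white_color).
  rewrite /g -[0]/(0%:~R) ltr_int /height; case: (c I) => [[]|] //=.
  by rewrite subr_lt0 ltz_nat ltnS -[X in (_ <= X)%N]card_ord max_card.
have gb : (0 < g I) = (c I == black_color).
  rewrite /g -[0]/(0%:~R) ltr_int /height; case: (c I) => [[]|] //=.
  apply/negP; apply/negP; rewrite -leNgt ltW //.
  by rewrite subr_lt0 ltz_nat ltnS -[X in (_ <= X)%N]card_ord max_card.
have ew : (level_color y 0 I == white_color) = (c I == white_color).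
  rewrite -gw; apply/level_color_whiteP/idP => [/(_ k kI)|gI i iI].
    by rewrite yk.
  exact: le_lt_trans (y_le I i IQ iI) gI.
have eb : (level_color y 0 I == black_color) = (c I == black_color).
  rewrite -gb; apply/level_color_blackP/idP => [[i iI yi]|gI].
    exact: lt_le_trans yi (y_le I i IQ iI).
  by exists k; rewrite ?yk.
by move: ew eb; case: (level_color y 0 I) (c I) => [[]|] [[]|].
Qed.

End Levels.

From mathcomp Require Import boolp classical_sets functions reals.
Local Open Scope classical_set_scope.

(** * Faces of Minkowski sums of simplices *)

Definition dot (R : realType) (d : nat) (y x : 'rV[R]_d) : R := \sum_i y 0 i * x 0 i.

Definition face_of (R : realType) (d : nat) (P : set 'rV[R]_d) (y : 'rV[R]_d) :
    set 'rV[R]_d :=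
  [set x | P x /\ forall z, P z -> dot y z <= dot y x].

Section Simplex.
Variables (R : realType) (d : nat).
Implicit Types (x y z : 'rV[R]_d) (K : {set 'I_d}) (m : R).

Lemma dot_delta y i : dot y (delta_mx 0 i) = y 0 i.
Proof.
rewrite /dot (bigD1 i) //= mxE !eqxx mulr1 big1 ?addr0 // => j ji.
by rewrite mxE (negPf ji) andbF mulr0.
Qed.

Lemma dot_sum (I : finType) (A : {set I}) (p : I -> 'rV[R]_d) y :
  dot y (\sum_(j in A) p j) = \sum_(j in A) dot y (p j).
Proof.
rewrite /dot exchange_big /=; apply: eq_bigr => i _.
by rewrite summxE mulr_sumr.
Qed.

Lemma Delta_delta K i : i \in K -> Delta K (delta_mx 0 i : 'rV[R]_d).
Proof.
move=> iK; exists 1, (fun=> delta_mx 0 i), (fun=> 1); split=> //.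
- by move=> _; exists i.
- by rewrite big_ord1.
- by rewrite big_ord1 scale1r.
Qed.

Lemma Delta_coord K x : Delta K x ->
  [/\ forall i, 0 <= x 0 i, \sum_i x 0 i = 1 & forall i, i \notin K -> x 0 i = 0].
Proof.
move=> [k [p [c [hp c0 c1 ->]]]].
have pE l i : 0 <= p l 0 i.
  by have [j _ ->] := hp l; rewrite mxE ler0n.
split=> [i||i iK].
- by rewrite summxE sumr_ge0 // => l _; rewrite mxE mulr_ge0.
- under eq_bigr do rewrite summxE.
  rewrite exchange_big /= -[RHS]c1; apply: eq_bigr => l _.
  under eq_bigr do rewrite mxE.
  rewrite -mulr_sumr; have [j _ ->] := hp l.
  (* The sum of the coordinates is the product with the all-ones vector. *)
  have := dot_delta (const_mx 1) j; rewrite /dot mxE => e.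
  rewrite -[X in _ * X](_ : \sum_i (const_mx 1 : 'rV[R]_d) 0 i * (delta_mx 0 j : 'rV[R]_d) 0 i = _).
    by rewrite e mulr1.
  by apply: eq_bigr => i _; rewrite mxE mul1r.
- rewrite summxE big1 // => l _; rewrite mxE.
  have [j jK ->] := hp l; rewrite mxE eqxx /=.
  case: eqP => [eij|]; last by rewrite mulr0.
  by rewrite eij jK in iK.
Qed.

Lemma Delta_dot_le K x y m : Delta K x -> {in K, forall i, y 0 i <= m} -> dot y x <= m.
Proof.
move=> /Delta_coord[x0 x1 xK] ym; rewrite -[m]mulr1 -x1 mulr_sumr.
apply: ler_sum => i _; have [iK|/xK->] := boolP (i \in K); last by rewrite !mulr0.
by rewrite ler_wpM2r // ym.
Qed.

(** The terms [(m - y 0 i) * x 0 i] are nonnegative with sum zero, so [x] is supported on the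
    maximizers of [y], where [z] is constant. *)
Lemma Delta_dot_eq K x y z m m' : Delta K x -> {in K, forall i, y 0 i <= m} ->
  dot y x = m -> {in K, forall i, y 0 i = m -> z 0 i = m'} -> dot z x = m'.
Proof.
move=> /Delta_coord[x0 x1 xK] ym eyx zm.
have h0 i : 0 <= (m - y 0 i) * x 0 i.
  have [iK|/xK->] := boolP (i \in K); last by rewrite mulr0.
  by rewrite mulr_ge0 // subr_ge0 ym.
have : \sum_i (m - y 0 i) * x 0 i = 0.
  under eq_bigr do rewrite mulrBl.
  by rewrite sumrB -mulr_sumr x1 mulr1 [X in _ - X]eyx subrr.
move/psumr_eq0P => /(_ (fun i _ => h0 i)) h.
rewrite -[m']mulr1 -x1 mulr_sumr; apply: eq_bigr => i _.
have [iK|/xK->] := boolP (i \in K); last by rewrite !mulr0.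
have /eqP := h i isT; rewrite mulf_eq0 subr_eq0 => /orP[/eqP emy|/eqP->].
  by rewrite zm.
by rewrite !mulr0.
Qed.

End Simplex.

Section MinkowskiSumOfSimplices.
Variables (R : realType) (d : nat) (I : finType) (A : {set I}) (G : I -> {set 'I_d.+1}).
Hypothesis G0 : forall j, j \in A -> G j != finset.set0.
Implicit Types (y z : 'rV[R]_d.+1) (f : I -> 'I_d.+1).
Local Notation P := (mink_sum A (fun j => Delta (R := R) (G j))).

Definition vertex_sum f : 'rV[R]_d.+1 := \sum_(j in A) delta_mx 0 (f j).

Lemma vertex_sum_in f : (forall j, j \in A -> f j \in G j) -> P (vertex_sum f).
Proof. by move=> hf; exists (fun j => delta_mx 0 (f j)) => // j /hf/Delta_delta. Qed.

Lemma dot_vertex_sum y f : dot y (vertex_sum f) = \sum_(j in A) y 0 (f j).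
Proof. by rewrite dot_sum; apply: eq_bigr => j _; rewrite dot_delta. Qed.

Definition selects_argmax y f : Prop :=
  forall j, j \in A -> f j \in G j /\ {in G j, forall i, y 0 i <= y 0 (f j)}.

Lemma selects_argmax_exists y : exists f, selects_argmax y f.
Proof.
have [|f hf] := @choice I 'I_d.+1 (fun j i => j \in A -> i \in G j /\
  {in G j, forall k, y 0 k <= y 0 i}); last by exists f.
(* Outside [A] the selection takes the junk value [ord0], available because the dimension is a
   successor. *)
move=> j; have [jA|jA] := boolP (j \in A); last by exists ord0.
by have [i iG hi] := argmax_exists (y 0) (G0 jA); exists i.
Qed.

Lemma selects_argmax_le y f x : selects_argmax y f -> P x ->
  dot y x <= \sum_(j in A) y 0 (f j).
Proof.
move=> hf [p hp ->]; rewrite dot_sum; apply: ler_sum => j jA.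
by apply: Delta_dot_le (hp j jA) _; case: (hf j jA).
Qed.

Lemma vertex_sum_face y f : selects_argmax y f -> face_of P y (vertex_sum f).
Proof.
move=> hf; split; first by apply: vertex_sum_in => j /hf[].
by move=> x Px; rewrite dot_vertex_sum; apply: selects_argmax_le.
Qed.

Lemma face_of_neq0 y : face_of P y !=set0.
Proof.
by have [f hf] := selects_argmax_exists y; exists (vertex_sum f); apply: vertex_sum_face.
Qed.

(** A functional is maximal at a sum exactly when it is maximal at each term, so inclusion of faces
    can be tested one summand at a time, and there on vertices. *)
Lemma face_of_subset y z :
  face_of P y `<=` face_of P z <->
  {in A, forall j, {in G j, forall i, {in G j, forall k, y 0 k <= y 0 i} ->
                                      {in G j, forall k, z 0 k <= z 0 i}}}.
Proof.
have [f hf] := selects_argmax_exists y.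
split=> [sub j0 j0A i iG hi k kG|h x [[p hp ex] hx]].
  (* Changing a maximizing selection at [j0] only: the sums for [i] and [k] differ by this single
     term, so comparing them under [z] compares [z 0 k] with [z 0 i]. *)
  pose g l := fun j => if j == j0 then l else f j.
  have gG l : l \in G j0 -> forall j, j \in A -> g l j \in G j.
    by move=> lG j /hf[fj _]; rewrite /g; case: eqP => [->|].
  have hg : selects_argmax y (g i).
    move=> j jA; split; first exact: gG.
    by rewrite /g; case: eqP => [->//|_]; case: (hf j jA).
  have [_ /(_ _ (vertex_sum_in (gG k kG)))] := sub _ (vertex_sum_face hg).
  rewrite !dot_vertex_sum !(bigD1 j0 j0A) /= /g !eqxx.
  have e l : \sum_(j in A | j != j0) z 0 (if j == j0 then l else f j)
           = \sum_(j in A | j != j0) z 0 (f j).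
    by apply: eq_bigr => j /andP[_ /negPf->].
  by rewrite !e lerD2r.
have le_pj j : j \in A -> dot y (p j) <= y 0 (f j).
  by move=> jA; apply: Delta_dot_le (hp j jA) _; case: (hf j jA).
(* The gaps are nonnegative, and their sum is at most zero because [x] does at least as well as the
   vertex sum of [f]. *)
have eq_pj j : j \in A -> dot y (p j) = y 0 (f j).
  move=> jA; apply/eqP; rewrite -subr_eq0 -oppr_eq0 opprB; apply/eqP.
  move: j jA; apply: (@psumr_eq0P _ _ _ (fun j => y 0 (f j) - dot y (p j))).
    by move=> j jA; rewrite subr_ge0 le_pj.
  apply/eqP; rewrite sumrB eq_le subr_le0 subr_ge0; apply/andP; split; last exact: ler_sum.
  have := hx (vertex_sum f); rewrite dot_vertex_sum ex dot_sum => hv.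
  by apply: hv; apply: vertex_sum_in => j /hf[].
have hfz : selects_argmax z f.
  by move=> j jA; have [fj mj] := hf j jA; split=> //; apply: h.
split; first by exists p.
move=> w Pw; apply: le_trans (selects_argmax_le hfz Pw) _.
rewrite ex dot_sum; apply: ler_sum => j jA.
have [fj mj] := hf j jA.
rewrite (@Delta_dot_eq _ _ (G j) (p j) y z (y 0 (f j)) (z 0 (f j))) //.
- exact: hp.
- exact: eq_pj.
move=> i iG eyi; apply/eqP; rewrite eq_le.
have [_ mz] := hfz j jA; rewrite mz //=.
by apply: (h j jA i iG) => // k kG; rewrite eyi; apply: mj.
Qed.

End MinkowskiSumOfSimplices.

(** * Faces of the nestomultiplihedron *)

(** Indexing by pairs merges the two Minkowski sums into one; [true] marks the simplices with the
    extra vertex. *)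
Definition summand (n : nat) (u : bool * {set 'I_n}) : {set 'I_n.+1} :=
  if u.1 then (ord_max |: Defs.incl u.2)%SET else Defs.incl u.2.

Section Nestomultiplihedron.
Variables (R : realType) (n : nat) (B : {set {set 'I_n}}).
Hypothesis hB : building_set B.
Implicit Types (y z : 'rV[R]_n.+1) (i j k : 'I_n).
Local Notation emb := (widen_ord (leqnSn n)).
Local Notation A := (finset.setX [set: bool]%SET B).
Local Notation P := (nestomultiplihedron R B).

Lemma nestomultiplihedronE : P = mink_sum A (fun u => Delta (R := R) (summand u)).
Proof.
have sumE (F : bool * {set 'I_n} -> 'rV[R]_n.+1) :
    \sum_(u in A) F u = \sum_(I in B) F (false, I) + \sum_(I in B) F (true, I).
  transitivity (\sum_(b : bool) \sum_(I in B) F (b, I)).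
    by rewrite pair_big_dep /=; apply: eq_big => [u|[b I] //]; rewrite !inE.
  by rewrite big_bool addrC.
apply/seteqP; split=> x.
  case=> _ [_ [[p hp ->] [q hq ->] ->]].
  exists (fun u => if u.1 then q u.2 else p u.2); last by rewrite sumE.
  by move=> [[] I]; rewrite !inE; [apply: hq|apply: hp].
case=> p hp ->; rewrite sumE.
exists (\sum_(I in B) p (false, I)), (\sum_(I in B) p (true, I)); split=> //.
  by exists (fun I => p (false, I)) => // I IB; apply: (hp (false, I)); rewrite !inE.
by exists (fun I => p (true, I)) => // I IB; apply: (hp (true, I)); rewrite !inE.
Qed.

Lemma mem_incl (I : {set 'I_n}) i : (emb i \in Defs.incl I) = (i \in I).
Proof. by rewrite mem_imset // => a b /(congr1 val)/= e; apply: val_inj. Qed.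

Lemma summand_neq0 u : u \in A -> summand u != finset.set0.
Proof.
case: u => b I; rewrite !inE /= => IB; have /set0Pn[i iI] := building_neq0 hB IB.
by apply/set0Pn; exists (emb i); rewrite /summand; case: b; rewrite /= ?inE mem_incl iI ?orbT.
Qed.

Definition restrict y : 'I_n -> R := fun i => y 0 (emb i).

(** The first clause of [argmax_sub] is the summand of [I]. The other two compare an element of [I]
    with the extra vertex, in either direction; a comparison of two elements of [I] within the
    larger simplex reduces to the first clause. *)
Lemma face_of_nestomultiplihedron_subset y z :
  face_of P y `<=` face_of P z <->
  argmax_sub B (restrict y) (y 0 ord_max) (restrict z) (z 0 ord_max).
Proof.
rewrite nestomultiplihedronE; split=> [/(face_of_subset summand_neq0) h I IB|h].
  have hf : (false, I) \in A by rewrite !inE.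
  have ht : (true, I) \in A by rewrite !inE.
  split.
  - move=> i iI hi j jI; have := h _ hf (emb i); rewrite /summand /= mem_incl.
    move=> /(_ iI) h1; apply: h1; last by rewrite mem_incl.
    by move=> _ /imsetP[l lI ->]; apply: hi.
  - move=> i iI hi ti; have := h _ ht (emb i); rewrite /summand /= inE mem_incl iI orbT.
    move=> /(_ isT) h1; apply: h1; last by rewrite !inE eqxx.
    by move=> _ /setU1P[->//|/imsetP[l lI ->]]; apply: hi.
  - move=> ht' j jI; have := h _ ht ord_max; rewrite /summand /= setU11.
    move=> /(_ isT) h1; apply: h1; last by rewrite !inE mem_incl jI orbT.
    by move=> _ /setU1P[->//|/imsetP[l lI ->]]; apply: ht'.
apply/(face_of_subset summand_neq0) => -[[] I]; rewrite !inE /= => IB.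
all: have [h1 h2 h3] := h I IB.
all: rewrite /summand /=.
- move=> _ /setU1P[->|/imsetP[i iI ->]] hi.
    move=> _ /setU1P[->//|/imsetP[k kI ->]]; apply: h3 => // j jI.
    by apply: hi; rewrite !inE mem_incl jI orbT.
  have hi' : {in I, forall j, restrict y j <= restrict y i}.
    by move=> j jI; apply: hi; rewrite !inE mem_incl jI orbT.
  move=> _ /setU1P[->|/imsetP[k kI ->]]; last exact: h1.
  by apply: h2 => //; apply: hi; rewrite setU11.
- move=> _ /imsetP[i iI ->] hi _ /imsetP[k kI ->]; apply: (h1 i iI) => // j jI.
  by apply: hi; rewrite mem_incl.
Qed.

Lemma face_of_nestomultiplihedron_neq0 y : face_of P y !=set0.
Proof. by rewrite nestomultiplihedronE; apply: (face_of_neq0 summand_neq0). Qed.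

Lemma vector_of_levels (a : 'I_n -> R) (t : R) :
  exists y : 'rV[R]_n.+1, restrict y =1 a /\ y 0 ord_max = t.
Proof.
(* [insub] fails only at the last index, where [oapp] returns [t]. *)
exists (\row_i oapp a t (insub (val i))); split=> [i|]; rewrite /restrict mxE /=.
  by rewrite valK.
by rewrite insubF ?ltnn.
Qed.

(** * The correspondence between faces and painted forests *)

Definition painted_of_vector y : painted n :=
  painted_of_nested (level_sets B (restrict y)) (level_color (restrict y) (y 0 ord_max)).

Lemma painted_of_vector_B_forest y : painted_B_forest B (painted_of_vector y).
Proof.
apply/(painted_B_forest_of_nested _ hB (nested_level_sets hB _)).
exact: monotone_level_color.
Qed.

Lemma painted_of_vector_ge y z :
  face_of P y `<=` face_of P z <->
  painted_ge B (painted_of_vector y) (painted_of_vector z).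
Proof.
have hy := nested_level_sets hB (restrict y).
have hz := nested_level_sets hB (restrict z).
rewrite face_of_nestomultiplihedron_subset argmax_sub_coarsens //; split.
  by apply: coarsens_painted_ge => //; apply: monotone_level_color.
exact: painted_ge_coarsens.
Qed.

(** Many vectors cut out the same face. By antisymmetry of [coarsens] they share the nested set and
    its colors, so the forest depends on the face only. *)
Lemma painted_of_vector_face y z : face_of P y = face_of P z ->
  painted_of_vector y = painted_of_vector z.
Proof.
move=> e.
have /face_of_nestomultiplihedron_subset : face_of P y `<=` face_of P z by rewrite e.
have /face_of_nestomultiplihedron_subset : face_of P z `<=` face_of P y by rewrite e.
rewrite !argmax_sub_coarsens // => h1 h2.
have [eL eC] := coarsens_antisym h2 h1.
by rewrite /painted_of_vector (eq_painted_of_nested eC) eL.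
Qed.

Lemma painted_of_vector_surj N : painted_B_forest B N ->
  exists y, painted_of_vector y = N.
Proof.
move=> hN; have [hF _] := hN.
have hQ := nested_of_B_forest hF.
have eN := nested_of_paintedK hN.
have mc : monotone_coloring (nested_of_forest N) (coloring_of_painted N).
  by apply/(painted_B_forest_of_nested _ hB hQ); rewrite eN.
have [a [t [eL eC]]] := level_realization R hB hQ mc.
have [y [ya yt]] := vector_of_levels a t; exists y.
have {}ya : restrict y = a by apply/funext.
by rewrite /painted_of_vector ya yt eL (eq_painted_of_nested eC).
Qed.

End Nestomultiplihedron.

Theorem theorem4p7 (R : realType) (n : nat) (B : {set {set 'I_n}})
    (hB : building_set B) :
  poset_iso (face (nestomultiplihedron R B)) (@subset 'rV[R]_n.+1)
            (painted_B_forest B) (opposite (painted_le B)).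
Proof.
set P := nestomultiplihedron R B.
(* The map picks a vector for each face by choice; sets that are not faces get the forest of the
   zero vector. *)
have [f hf] : exists f : set 'rV[R]_n.+1 -> painted n, forall F, face P F ->
    exists2 y, F = face_of P y & f F = painted_of_vector B y.
  have [|f hf] := @choice (set 'rV[R]_n.+1) (painted n) (fun F N => face P F ->
    exists2 y, F = face_of P y & N = painted_of_vector B y); last by exists f.
  move=> F; have [[_ [y ->]]|nF] := pselect (face P F).
    by exists (painted_of_vector B y) => _; exists y.
  by exists (painted_of_vector B (0 : 'rV[R]_n.+1)).
(* After unfolding [opposite] and [painted_le], this is the required equivalence: larger faces
   correspond to more contracted forests. *)
have ge F F' : face P F -> face P F' ->
    (F `<=` F' <-> painted_ge B (f F) (f F')).
  by move=> /hf[y -> ->] /hf[z -> ->]; apply: painted_of_vector_ge.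
exists f; split=> //; split.
- by move=> F /hf[y _ ->]; apply: painted_of_vector_B_forest.
(* Injectivity comes from the order equivalence: equal forests are related both ways by reflexivity,
   which gives both inclusions. *)
- move=> F F' /set_mem hF /set_mem hF' eF; apply/seteqP.
  by split; apply/ge => //; rewrite eF; apply: Relation_Operators.rt_refl.
- move=> N /(painted_of_vector_surj R hB)[y eN].
  have hy : face P (face_of P y).
    by split; [apply: face_of_nestomultiplihedron_neq0|exists y].
  exists (face_of P y) => //; have [z ez ->] := hf _ hy.
  by rewrite -eN; apply/esym/painted_of_vector_face.
Qed.
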